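(* Let $B\in H^1(\mathbb R^2)$ be real-valued. For every open, convex and bounded set $U\subset\mathbb R^2$ and every point $x_0\in U$, the following inequality holds: $$\int_U|\mathbf A_{\rm new}^U(x)-\mathbf A_{\rm av}^U(x)|^2\,dx\leq 8\,\delta^4\,\|\nabla B\|_{L^2(U)}^2,$$ where $\delta=\mathrm{diam}(U)$ is the diameter of $U$.
   Context: Let $\mathbf A_0(x)=\frac12(-x_2,x_1)$ for $x=(x_1,x_2)\in\mathbb R^2$. Given $U$ and $x_0\in U$, let $|U|$ denote the area of $U$ and define, for $x\in U$, $$\mathbf A_{\rm new}^U(x)=2\int_0^1 B\big(s(x-x_0)+x_0\big)\,\mathbf A_0\big(s(x-x_0)\big)\,ds,$$ $$B_{\rm av}^U=\frac1{|U|}\int_U B(x)\,dx,\qquad \mathbf A_{\rm av}^U(x)=B_{\rm av}^U\,\mathbf A_0(x-x_0).$$ *)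

(* Defs.v *)
From HB Require Import structures.
From mathcomp Require Import all_boot all_order all_algebra.
From mathcomp Require Import all_classical all_reals all_analysis.

Set Implicit Arguments.
Unset Strict Implicit.
Unset Printing Implicit Defensive.

Import Order.TTheory GRing.Theory Num.Theory.
Import numFieldNormedType.Exports.

Local Open Scope classical_set_scope.
Local Open Scope ring_scope.

(* The topology and vector space structure of the product are those of R^2, but
   the library norm `|x| on a product is the max norm, hence enorm below. *)
Notation plane R := (R * R)%type.

Definition enorm (R : realType) (x : plane R) : R :=
  Num.sqrt (x.1 ^+ 2 + x.2 ^+ 2).

Definition diam (R : realType) (U : set (plane R)) : R :=
  sup [set enorm (x - y) | x in U & y in U].

(* Two-dimensional Lebesgue measure, on the Borel sigma-algebra. *)
Definition leb2 (R : realType) :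
    {measure set (measurableTypeR R * measurableTypeR R) -> \bar R} :=
  (@lebesgue_measure R \x @lebesgue_measure R)%E.

Definition ebasis (R : realType) (i : 'I_2) : plane R :=
  if i == ord0 then (1, 0) else (0, 1).

Definition coord (R : realType) (i : 'I_2) (v : plane R) : R :=
  if i == ord0 then v.1 else v.2.

Definition partial (R : realType) (i : 'I_2) (f : plane R -> R) : plane R -> R :=
  'D_(ebasis R i) f.

Definition iter_partial (R : realType) (s : seq 'I_2) (f : plane R -> R) :
    plane R -> R :=
  foldr (@partial R) f s.

(* C^oo: all iterated partial derivatives exist and are continuous.
   Derivability is needed because 'D_v is total. *)
Definition smooth (R : realType) (f : plane R -> R) : Prop :=
  forall s : seq 'I_2, continuous (iter_partial s f) /\
    forall i x, derivable (iter_partial s f) x (ebasis R i).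

(* C_c^oo(R^2) *)
Definition test_function (R : realType) (f : plane R -> R) : Prop :=
  smooth f /\ compact (closure [set x | f x != 0]).

(* L^2(R^2); elements are represented by Borel functions. *)
Definition L2 (R : realType) (f : plane R -> R) : Prop :=
  f \in Lfun (@leb2 R) 2%:E.

Definition weak_partial (R : realType) (i : 'I_2) (f g : plane R -> R) : Prop :=
  forall phi, test_function phi ->
    \int[@leb2 R]_x (f x * partial i phi x) = - \int[@leb2 R]_x (g x * phi x).

(* DB represents the (a.e. unique) weak gradient of B, with components in L^2. *)
Definition L2_gradient (R : realType) (B : plane R -> R)
    (DB : plane R -> plane R) : Prop :=
  forall i, L2 (fun x => coord i (DB x)) /\
            weak_partial i B (fun x => coord i (DB x)).

Definition H1 (R : realType) (B : plane R -> R) : Prop :=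
  L2 B /\ exists DB, L2_gradient B DB.

(* L^2(U) norm of a vector field *)
Definition L2norm (R : realType) (U : set (plane R))
    (F : plane R -> plane R) : \bar R :=
  'N[@leb2 R]_(2%:E)[EFin \o ((@enorm R \o F) \_ U)].

Definition A0 (R : realType) (x : plane R) : plane R := 2^-1 *: (- x.2, x.1).

(* The ray integral of the vector field is taken componentwise. For B in L^2 it
   converges for a.e. x, and a change of B on a null set changes it only for x in
   a null set; where it diverges Rintegral returns a real number by convention. *)
Definition Anew (R : realType) (B : plane R -> R) (x0 x : plane R) : plane R :=
  let V (s : R) := B (s *: (x - x0) + x0) *: A0 (s *: (x - x0)) in
  2 *: (\int[@lebesgue_measure R]_(s in `[0, 1]) (V s).1,
        \int[@lebesgue_measure R]_(s in `[0, 1]) (V s).2).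

Definition Bav (R : realType) (B : plane R -> R) (U : set (plane R)) : R :=
  (fine (leb2 R U))^-1 * \int[@leb2 R]_(x in U) B x.

Definition Aav (R : realType) (B : plane R -> R) (U : set (plane R))
    (x0 x : plane R) : plane R :=
  Bav B U *: A0 (x - x0).

(* Main.v *)
Require Import Defs.
From HB Require Import structures.
From mathcomp Require Import all_boot all_order all_algebra.
From mathcomp Require Import all_classical all_reals all_analysis.
From mathcomp Require Import measurable_realfun ring lra.

Set Implicit Arguments.
Unset Strict Implicit.
Unset Printing Implicit Defensive.

Import Order.TTheory GRing.Theory Num.Theory.
Import numFieldNormedType.Exports.

Local Open Scope classical_set_scope.
Local Open Scope ring_scope.

(** Write C for B minus its average over U. Since 2 * int_0^1 s ds = 1, the
    vector potential with the constant field B_av is a ray integral as well,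
    and the difference of the two potentials at x is x - x0 turned by a right
    angle, times int_0^1 s C(x0 + s(x - x0)) ds. By Cauchy-Schwarz its square
    is at most delta^2 int_0^1 s^2 C(x0 + s(x - x0))^2 ds ([Anew_Aav_le]). For
    fixed s the dilation x |-> x0 + s(x - x0) maps the convex set U into itself
    with Jacobian s^2, which the factor s^2 cancels, so the integral over U is
    at most delta^2 int_U C^2 ([spoke_le]).

    It remains to prove the Poincare inequality
    int_U C^2 <= 4 delta^2 int_U |DB|^2 ([poincare_le]); the total constant is
    then 4. By Cauchy-Schwarz |U| int_U C^2 is at most the double integral of
    (B x - B y)^2 over U x U. The increment of B from x to x + h is the average
    of the scalar product h . DB over the segment joining them, so that its
    square is at most delta^2 int_0^1 |DB(x + t h)|^2 dt ([osc_le_segment]),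
    where the segment stays in U. For fixed t, move the endpoint that is the
    nearer to x + t h and keep the other one: x + t h moves with a ratio at
    least 1/2, so the double integral charges each point z of U with at most
    4 |U| |DB z|^2 ([segment_weight_le]).

    The gradient being weak, the formula for the increments has to be read
    almost everywhere in x, for each h ([increment_ray]). Against a test
    function phi both sides agree: Fubini and a translation move the increment
    and the average over the segment onto phi, where the formula is the
    fundamental theorem of calculus, and the definition of DB moves the
    derivative back ([pairing_ray], [ray_dtensor], [pairing_dtensor]). Finally,
    a function orthogonal to all products u(x1) v(x2) of smooth bumps vanishes
    almost everywhere ([ae_eq0_of_test_functions]): bumps built from exp(-1/t)
    converge boundedly to the indicator functions of open intervals, so all
    integrals over open rectangles vanish, and these rectangles generate the
    Borel sets. *)

(** * Lebesgue measure on the plane *)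

(** The carriers of R and R^2, with the sigma-algebras on which [leb2] is
    defined. *)
Notation line R := (measurableTypeR R).
Notation mplane R := (measurableTypeR R * measurableTypeR R)%type.
Notation leb := lebesgue_measure.

Section plane_measure.
Context (R : realType).
Local Open Scope ereal_scope.

Lemma leb2_rectangle (A C : set (line R)) : measurable A -> measurable C ->
  leb2 R (A `*` C) = leb A * leb C.
Proof. exact: product_measure1E. Qed.

Lemma leb_oo (a b : R) : (a <= b)%R -> leb (`]a, b[%classic : set (line R)) = (b - a)%:E.
Proof.
rewrite le_eqVlt lebesgue_measure_itv/= lte_fin => /predU1P[->|->].
  by rewrite ltxx subrr.
by rewrite EFinB.
Qed.

Definition box (n : nat) : set (mplane R) :=
  `](- n%:R)%R, n%:R[%classic `*` `](- n%:R)%R, n%:R[%classic.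

Lemma measurable_box n : measurable (box n).
Proof. by apply: measurableX; exact: measurable_itv. Qed.

Lemma box_lty n : leb2 R (box n) < +oo.
Proof.
have h : leb (`](- n%:R)%R, n%:R[%classic : set (line R)) = (n%:R - - n%:R)%:E.
  by rewrite leb_oo// ge0_cp.
rewrite [X in X < _]leb2_rectangle; [|exact: measurable_itv..].
by rewrite h -EFinM ltry.
Qed.

Lemma bigcup_box : \bigcup_n box n = setT.
Proof.
apply/seteqP; split=> // -[x y] _.
pose n := maxn (Num.bound x) (Num.bound y).
have h (z : R) (m : nat) : (Num.bound z <= m)%N -> (- m%:R < z < m%:R)%R.
  move=> zm; rewrite -ltr_norml (lt_le_trans (unstable.ltr_norm_bound z))//.
  by rewrite ler_nat.
by exists n => //; split; rewrite /= in_itv/= h// /n ?leq_maxl ?leq_maxr.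
Qed.

Lemma leb2_sigma_finite : sigma_finite setT (leb2 R).
Proof.
exists box; first by rewrite bigcup_box.
by move=> n; split; [exact: measurable_box|exact: box_lty].
Qed.

Let sigma_finite_leb2 := Measure_isSigmaFinite.Build _ _ _ (leb2 R : set (mplane R) -> \bar R)
  leb2_sigma_finite.
(** The measure [leb2], bundled with its sigma-finiteness: Tonelli and Fubini on
    products with the plane ask for it. *)
Definition plebesgue : {sigma_finite_measure set (mplane R) -> \bar R} :=
  HB.pack (leb2 R : set (mplane R) -> \bar R) (Measure.class (leb2 R))
    sigma_finite_leb2.

End plane_measure.

Section affine.
Context (R : realType).
Local Open Scope ereal_scope.
Implicit Types (a b : R).

Let affine_measurable a b :
  measurable_fun [set: line R] (fun x : line R => (a * x + b)%R : line R).
Proof. by apply: measurable_funD => //; apply: measurable_funM. Qed.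

(** The image of [leb] is a measure only in the presence of the measurability
    proof, hence the explicit instance. *)
Let affine_image a b : {measure set (line R) -> \bar R} :=
  measure_function_pushforward__canonical__measure_function_Measure leb
    (affine_measurable a b).

(** By uniqueness of Lebesgue measure it is enough to compare the two sides on
    half-open intervals. *)
Lemma lebesgue_affine a b (A : set (line R)) : (0 < a)%R -> measurable A ->
  leb A = a%:E * pushforward leb (fun x : line R => (a * x + b)%R : line R) A.
Proof.
move=> a0; move: A.
apply: (@lebesgue_measure_unique R (mscale (NngNum (ltW a0)) (affine_image a b))).
move=> _ [[c d]] _ <-.
transitivity (a%:E * leb (`]((c - b) / a)%R, ((d - b) / a)%R]%classic : set (line R))).
  rewrite !lebesgue_measure_itv/= !lte_fin ltr_pM2r ?invr_gt0// ltrD2r.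
  case: ifPn => _; last by rewrite mule0.
  by rewrite -!EFinB -EFinM; congr (_%:E); field; rewrite gt_eqF.
congr (_ * leb _); apply/seteqP.
by split => x; rewrite /= !in_itv/= ltr_pdivrMr// ler_pdivlMr// ltrBlDr lerBrDr (mulrC x).
Qed.

Lemma integral_affine a b (f : line R -> \bar R) : (0 < a)%R ->
  measurable_fun [set: line R] f -> (forall x, 0 <= f x) ->
  \int[leb]_x f (a * x + b)%R = a^-1%:E * \int[leb]_x f x.
Proof.
move=> a0 mf f0.
have -> : \int[leb]_x f x = a%:E * \int[affine_image a b]_x f x.
  rewrite -(ge0_integral_mscale (affine_image a b) measurableT (NngNum (ltW a0)) mf)//.
  by apply: eq_measure_integral => A mA _; exact: (lebesgue_affine b a0 mA).
rewrite muleA -EFinM mulVf ?gt_eqF// mul1e.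
by rewrite (@ge0_integral_pushforward _ _ _ _ _ _ (affine_measurable a b))// preimage_setT.
Qed.

End affine.

(** * Change of variables in the plane and Cauchy-Schwarz *)
Section plane_integrals.
Context (R : realType).
Local Open Scope ereal_scope.

Lemma leb2_tonelli (f : mplane R -> \bar R) :
  measurable_fun [set: mplane R] f -> (forall x, 0 <= f x) ->
  \int[leb2 R]_z f z = \int[leb]_x \int[leb]_y f (x, y).
Proof.
move=> mf f0.
pose m : {sigma_finite_measure set (line R) -> \bar R} := @lebesgue_measure R.
exact: (@fubini_tonelli1 _ _ (line R) (line R) R m m f mf f0).
Qed.

Lemma leb2_leb_swap (f : mplane R -> line R -> \bar R) :
  measurable_fun [set: mplane R * line R] (fun p => f p.1 p.2) ->
  (forall x t, 0 <= f x t) ->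
  \int[leb2 R]_x \int[leb]_t f x t = \int[leb]_t \int[leb2 R]_x f x t.
Proof.
move=> mf f0.
pose m : {sigma_finite_measure set (line R) -> \bar R} := @lebesgue_measure R.
exact: (@fubini_tonelli _ _ (mplane R) (line R) R (plebesgue R) m _ mf (fun p => f0 p.1 p.2)).
Qed.

Lemma leb2_leb2_swap (f : mplane R -> mplane R -> \bar R) :
  measurable_fun [set: mplane R * mplane R] (fun p => f p.1 p.2) ->
  (forall x t, 0 <= f x t) ->
  \int[leb2 R]_x \int[leb2 R]_t f x t = \int[leb2 R]_t \int[leb2 R]_x f x t.
Proof.
move=> mf f0.
exact: (@fubini_tonelli _ _ (mplane R) (mplane R) R (plebesgue R) (plebesgue R) _ mf
  (fun p => f0 p.1 p.2)).
Qed.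

Lemma measurable_fun_plane d (T : measurableType d) (f : T -> mplane R) :
  measurable_fun [set: T] (fun x => (f x).1 : R) ->
  measurable_fun [set: T] (fun x => (f x).2 : R) ->
  measurable_fun [set: T] f.
Proof. by move=> f1 f2; apply/measurable_fun_pairP; split. Qed.

Lemma measurable_plane_fst : measurable_fun [set: mplane R] (fun x : mplane R => x.1 : R).
Proof. exact: (@measurable_fst _ _ (line R) (line R)). Qed.

Lemma measurable_plane_snd : measurable_fun [set: mplane R] (fun x : mplane R => x.2 : R).
Proof. exact: (@measurable_snd _ _ (line R) (line R)). Qed.

Lemma measurable_fun_plane1 d (T : measurableType d) (f : T -> mplane R) :
  measurable_fun [set: T] f -> measurable_fun [set: T] (fun x => (f x).1 : R).
Proof. by move=> mf; exact: (measurableT_comp measurable_plane_fst mf). Qed.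

Lemma measurable_fun_plane2 d (T : measurableType d) (f : T -> mplane R) :
  measurable_fun [set: T] f -> measurable_fun [set: T] (fun x => (f x).2 : R).
Proof. by move=> mf; exact: (measurableT_comp measurable_plane_snd mf). Qed.

Lemma measurable_fun_planeD d (T : measurableType d) (f g : T -> mplane R) :
  measurable_fun [set: T] f -> measurable_fun [set: T] g ->
  measurable_fun [set: T] (fun x => ((f x : plane R) + g x)%R : mplane R).
Proof.
move=> mf mg; apply: measurable_fun_plane => /=; apply: measurable_funD.
- exact: measurable_fun_plane1 mf.
- exact: measurable_fun_plane1 mg.
- exact: measurable_fun_plane2 mf.
- exact: measurable_fun_plane2 mg.
Qed.

Lemma measurable_fun_planeZ d (T : measurableType d) (c : T -> R) (f : T -> mplane R) :
  measurable_fun [set: T] c -> measurable_fun [set: T] f ->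
  measurable_fun [set: T] (fun x => (c x *: (f x : plane R))%R : mplane R).
Proof.
move=> mc mf; apply: measurable_fun_plane => /=; apply: measurable_funM => //.
- exact: measurable_fun_plane1 mf.
- exact: measurable_fun_plane2 mf.
Qed.

Lemma measurable_fun_planeN d (T : measurableType d) (f : T -> mplane R) :
  measurable_fun [set: T] f ->
  measurable_fun [set: T] (fun x => (- (f x : plane R))%R : mplane R).
Proof.
move=> mf; apply: measurable_fun_plane => /=; apply: measurableT_comp => //.
- exact: measurable_fun_plane1 mf.
- exact: measurable_fun_plane2 mf.
Qed.

Lemma integral_plane_affine (t : R) (h : plane R) (f : mplane R -> \bar R) :
  (0 < t)%R -> measurable_fun [set: mplane R] f -> (forall x, 0 <= f x) ->
  \int[leb2 R]_x f ((t *: (x : plane R) + h)%R) = (t ^- 2)%:E * \int[leb2 R]_x f x.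
Proof.
move=> t0 mf f0.
rewrite (leb2_tonelli mf)//.
rewrite (@leb2_tonelli (fun x : mplane R => f ((t *: (x : plane R) + h)%R)))//; last first.
  apply: measurableT_comp mf _; apply: measurable_fun_planeD => //.
  exact: measurable_fun_planeZ.
transitivity (\int[leb]_x (t^-1%:E * \int[leb]_y f ((t * x + h.1)%R, y))).
  apply: eq_integral => x _.
  rewrite -(@integral_affine R t h.2 (fun y => f ((t * x + h.1)%R, y)))//.
  exact: (measurable_fun_pair2 (_ : line R) mf).
rewrite ge0_integralZl ?lee_fin ?invr_ge0 ?ltW//; last 2 first.
- apply: (measurableT_comp (measurable_fun_fubini_tonelli_F f mf f0)).
  by apply: measurable_funD => //; apply: measurable_funM.
- by move=> x _; apply: integral_ge0.
rewrite (@integral_affine R t h.1 (fun x => \int[leb]_y f (x, y)))//; last 2 first.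
- exact: (measurable_fun_fubini_tonelli_F f mf f0).
- by move=> x; apply: integral_ge0.
by rewrite muleA -EFinM -invfM expr2.
Qed.

(** The positive and the negative parts are shifted separately. *)
Lemma integral_plane_shift (h : plane R) (f : mplane R -> \bar R) :
  measurable_fun [set: mplane R] f ->
  \int[leb2 R]_x f (((x : plane R) + h)%R) = \int[leb2 R]_x f x.
Proof.
move=> mf.
have shift (g : mplane R -> \bar R) : measurable_fun [set: mplane R] g ->
    (forall x, 0 <= g x) ->
    \int[leb2 R]_x g (((x : plane R) + h)%R) = \int[leb2 R]_x g x.
  move=> mg g0; rewrite -[RHS]mul1e -(@invr1 R) -(expr1n _ 2).
  rewrite -(integral_plane_affine h ltr01 mg g0).
  by apply: eq_integral => x _; rewrite scale1r.
have hp := shift _ (measurable_funepos mf) (fun x => funepos_ge0 f x).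
have hn := shift _ (measurable_funeneg mf) (fun x => funeneg_ge0 f x).
rewrite integralE [RHS]integralE -hp -hn.
by congr (_ - _); apply: eq_integral => x _; rewrite (funepos_comp, funeneg_comp).
Qed.

End plane_integrals.

Section cauchy_schwarz.
Context d (T : measurableType d) (R : realType) (mu : {measure set T -> \bar R}).

Lemma integrable_sqrE (D : set T) (f : T -> R) :
  measurable_fun D f ->
  (\int[mu]_(x in D) (f x ^+ 2)%:E < +oo)%E ->
  mu.-integrable D (EFin \o (fun x => f x ^+ 2)).
Proof.
move=> mf foo; apply/integrableP; split.
  by apply/measurable_EFinP; exact: measurable_funX.
by under eq_integral do rewrite gee0_abs ?lee_fin ?sqr_ge0//.
Qed.

Lemma integrable_cst (D : set T) (c : R) : measurable D -> (mu D < +oo)%E ->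
  mu.-integrable D (EFin \o cst c).
Proof.
by move=> mD Doo; apply: measurable_bounded_integrable => //; exact: bounded_cst.
Qed.

Lemma integrable_sqr (D : set T) (f : T -> R) :
  measurable D -> (mu D < +oo)%E -> measurable_fun D f ->
  (\int[mu]_(x in D) (f x ^+ 2)%:E < +oo)%E -> mu.-integrable D (EFin \o f).
Proof.
move=> mD Doo mf foo.
have i2 := integrable_sqrE mf foo.
have i1 := integrable_cst 1 mD Doo.
apply: (le_integrable mD _ _ (integrableD mD i2 i1)).
  exact/measurable_EFinP.
move=> x Dx; rewrite -[leLHS]/((`|f x|)%:E) -[leRHS]/((`|f x ^+ 2 + 1|)%:E) lee_fin.
rewrite [leRHS]ger0_norm ?addr_ge0 ?sqr_ge0//.
rewrite -[f x ^+ 2]ger0_norm ?sqr_ge0// normrX.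
have := normr_ge0 (f x); move: `|f x| => y y0; nra.
Qed.

(** Cauchy-Schwarz against the constant 1. When f is not square integrable on D
    the right-hand side is infinite; otherwise f is integrable since D has
    finite measure. *)
Lemma sqr_Rintegral_le (D : set T) (f : T -> R) :
  measurable D -> (0 < mu D)%E -> (mu D < +oo)%E -> measurable_fun D f ->
  (((\int[mu]_(x in D) f x) ^+ 2)%:E <=
     mu D * \int[mu]_(x in D) (f x ^+ 2)%:E)%E.
Proof.
move=> mD D0 Doo mf.
have [->|/eqP] := eqVneq (\int[mu]_(x in D) (f x ^+ 2)%:E)%E +oo%E.
  by rewrite gt0_muley// leey.
move=> /eqP; rewrite -ltey => foo.
have i1 := integrable_sqr mD Doo mf foo.
have i2 := integrable_sqrE mf foo.
have mfin : mu D \is a fin_num by rewrite ge0_fin_numE// ltW.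
have Ifin := integrable_fin_num mD i2.
rewrite -(fineK mfin) -(fineK Ifin) -EFinM lee_fin.
set m := fine (mu D); set a := \int[mu]_(x in D) f x; set I := fine _.
have m0 : 0 < m by rewrite fine_gt0// D0.
(* integrating 2 c f <= f^2 + c^2 is sharpest when c is the mean of f *)
pose c := a / m.
have : \int[mu]_(x in D) ((2 * c) * f x) <= \int[mu]_(x in D) (f x ^+ 2 + cst (c ^+ 2) x).
  apply: le_Rintegral => //.
  - exact: (integrableZl mD (2 * c) i1).
  - exact: (integrableD mD i2 (integrable_cst (c ^+ 2) mD Doo)).
  - by move=> x _ /=; have := sqr_ge0 (f x - c); rewrite sqrrB; lra.
rewrite RintegralZl// RintegralD//; last exact: integrable_cst.
rewrite Rintegral_cst// -/a -/m.
have -> : a = c * m by rewrite /c divfK ?gt_eqF.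
have -> : Rintegral mu D (fun x => f x ^+ 2) = I by [].
move=> h.
have {}h : c ^+ 2 * m <= I by lra.
rewrite exprMn expr2 mulrA [m * I]mulrC; nra.
Qed.

End cauchy_schwarz.

(** * Smooth functions on the line *)
Section smooth_line.
Context (R : realType).
Implicit Types (f g u v : R -> R).

(** An existential derivative, rather than the total operator [derive1], makes
    closure under sums and products a plain induction. *)
Fixpoint iter_derivable n f : Prop :=
  if n is m.+1 then
    exists2 f' : R -> R, (forall x : R, is_derive x (1 : R) f (f' x)) & iter_derivable m f'
  else continuous f.

Definition smooth1 f := forall n, iter_derivable n f.

Lemma is_derive_continuous f f' :
  (forall x : R, is_derive x (1 : R) f (f' x)) -> continuous f.
Proof.
by move=> df x; apply/differentiable_continuous/derivable1_diffP.
Qed.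

Lemma iter_derivableS n f : iter_derivable n.+1 f -> iter_derivable n f.
Proof.
elim: n f => [f [f' df _]|n IHn f [f' df f'n]]; first exact: is_derive_continuous df.
by exists f' => //; exact: IHn.
Qed.

Lemma iter_derivableD n f g :
  iter_derivable n f -> iter_derivable n g -> iter_derivable n (fun x => f x + g x).
Proof.
elim: n f g => [f g cf cg|n IHn f g [f' df f'n] [g' dg g'n]].
  by move=> x; apply: cvgD; [exact: cf|exact: cg].
by exists (fun x => f' x + g' x); [move=> x; exact: is_deriveD|exact: IHn].
Qed.

Lemma iter_derivableM n f g :
  iter_derivable n f -> iter_derivable n g -> iter_derivable n (fun x => f x * g x).
Proof.
elim: n f g => [f g cf cg|n IHn f g fn gn].
  by move=> x; apply: cvgM; [exact: cf|exact: cg].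
have [f' df f'n] := fn; have [g' dg g'n] := gn.
exists (fun x => f x * g' x + g x * f' x); first by move=> x; exact: is_deriveM.
by apply: iter_derivableD; apply: IHn => //; exact: iter_derivableS.
Qed.

Lemma iter_derivable_affine n f a b :
  iter_derivable n f -> iter_derivable n (fun x => f (a * x + b)).
Proof.
have da x : is_derive x (1 : R) (fun y : R => a * y + b) a.
  have h := is_deriveD (is_deriveZ a (is_derive_id x (1 : R))) (is_derive_cst b x (1 : R)).
  by apply: (is_derive_eq h); rewrite /= addr0; exact: mulr1.
elim: n f => [f cf|n IHn f [f' df f'n]].
  move=> x; apply: (@continuous_comp _ _ _ (fun y : R => a * y + b) f).
    exact: (is_derive_continuous da).
  exact: cf.
exists (fun x => a * f' (a * x + b)) => [x|].
  by rewrite mulrC; exact: (@is_derive1_comp R f (fun y : R => a * y + b) x _ _ (df _) (da x)).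
apply: (@iter_derivableM n (cst a)); last exact: IHn.
elim: n {IHn f'n} a {da} => [a|n IHn a] /=; first by move=> x; exact: cvg_cst.
by exists (cst 0); [move=> x; exact: is_derive_cst|exact: IHn].
Qed.

Lemma smooth1M f g : smooth1 f -> smooth1 g -> smooth1 (fun x => f x * g x).
Proof. by move=> sf sg n; exact: iter_derivableM. Qed.

Lemma smooth1_affine f a b : smooth1 f -> smooth1 (fun x => f (a * x + b)).
Proof. by move=> sf n; exact: iter_derivable_affine. Qed.

Lemma smooth1_is_derive f : smooth1 f -> forall x, is_derive x (1 : R) f (derive1 f x).
Proof.
move=> sf x; have [f' df _] := sf 1%N.
by apply: DeriveDef; [exact: ex_derive|rewrite derive1E].
Qed.

Lemma smooth1_continuous f : smooth1 f -> continuous f.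
Proof. by move=> sf; exact: (sf 0%N). Qed.

Lemma smooth1_derive1 f : smooth1 f -> smooth1 (derive1 f).
Proof.
move=> sf n; have [f' df f'n] := sf n.+1.
by have -> : derive1 f = f' by apply/funext => x; rewrite derive1E; exact: derive_val.
Qed.

(** For p = 1 this is the classical function exp(-1/t), smooth and flat at 0.
    With an arbitrary polynomial p in 1/t the family is stable under
    differentiation. *)
Definition flat (p : {poly R}) (t : R) : R :=
  if 0 < t then p.[t^-1] * expR (- t^-1) else 0.

Lemma horner_le_expR (p : {poly R}) :
  exists2 C : R, 0 <= C & forall y, 0 <= y -> `|p.[y]| <= C * expR y.
Proof.
exists (\sum_(i < size p) `|p`_i| * i`!%:R).
  by apply: sumr_ge0 => i _; rewrite mulr_ge0.
move=> y y0; rewrite horner_coef mulr_suml (le_trans (ler_norm_sum _ _ _))//.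
apply: ler_sum => i _; rewrite normrM -mulrA ler_wpM2l// normrX ger0_norm//.
rewrite mulrC -ler_pdivrMr ?ltr0n ?fact_gt0//.
case: i => -[_|i _] /=; first by rewrite expr0 fact0 divr1 -expR0 ler_expR.
by rewrite (le_trans _ (expR_ge1Dxn i y0))// lerDr.
Qed.

(** Put y = 1/t in the domination of the polynomial p X^2 by exp. The quadratic
    bound is what gives the derivative 0 at the origin. *)
Lemma flat_sqr_bound (p : {poly R}) :
  exists2 C : R, 0 <= C & forall t, `|flat p t| <= C * t ^+ 2.
Proof.
have [C C0 hC] := horner_le_expR (p * 'X ^+ 2).
exists C => // t; rewrite /flat; case: ifPn => t0; last first.
  by rewrite normr0 mulr_ge0// sqr_ge0.
have ti : 0 <= t^-1 by rewrite invr_ge0 ltW.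
have := hC _ ti; rewrite hornerM hornerXn normrM normrX (ger0_norm ti).
rewrite exprVn ler_pdivrMr ?exprn_gt0// => h.
rewrite normrM [`|expR _|]ger0_norm ?expR_ge0// expRN ler_pdivrMr ?expR_gt0//.
by rewrite mulrAC.
Qed.

Lemma is_derive0_sqr_bound (C : R) f : 0 <= C -> (forall t, `|f t| <= C * t ^+ 2) ->
  is_derive (0 : R) (1 : R) f 0.
Proof.
move=> C0 hC.
have f0 : f 0 = 0.
  by apply/eqP; rewrite -normr_le0 (le_trans (hC 0))// expr0n mulr0.
suff h : h^-1 *: ((f \o shift 0) (h *: (1 : R)) - f 0) @[h --> 0^'] --> (0 : R).
  by apply: DeriveDef; [apply/cvg_ex; exists 0|exact/cvg_lim].
apply/cvgrPdist_le => eps eps0; near=> h.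
have h0 : h != 0 by near: h; exact: nbhs_dnbhs_neq.
have hC1 : (C + 1) * `|h| <= eps.
  rewrite -ler_pdivlMl ?ltr_wpDl//; near: h.
  apply: dnbhs0_le; rewrite mulr_gt0// invr_gt0 ltr_wpDl//.
rewrite /= f0 subr0 sub0r normrN normrM normfV addr0.
rewrite ler_pdivrMl ?normr_gt0// (le_trans (hC _))//.
rewrite [_%:A]mulr1 -real_normK ?num_real// expr2 mulrCA ler_wpM2l//.
by rewrite (le_trans _ hC1)// ler_wpM2r// lerDl.
Unshelve. all: by end_near. Qed.

(** With y = 1/t one has dy/dt = - y^2, and the derivative of p(y) exp(-y) with
    respect to y is (p' - p)(y) exp(-y). *)
Lemma is_derive_flat (p : {poly R}) (x : R) :
  is_derive x (1 : R) (flat p) (flat ('X ^+ 2 * (p - p^`())) x).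
Proof.
have [x0|x0|->] := ltgtP x 0.
- apply: (@near_eq_is_derive _ _ _ (cst 0)) => //.
    near=> y; rewrite /flat ltNge ltW//.
    by near: y; exact: lt_nbhsl.
  by rewrite /flat ltNge ltW//; exact: is_derive_cst.
- pose F (t : R) : R := p.[t^-1] * expR (- t^-1).
  apply: (@near_eq_is_derive _ _ _ F) => //.
    near=> y; rewrite /flat /F ifT//.
    by near: y; exact: lt_nbhsr.
  rewrite /flat x0 hornerM hornerXn hornerD hornerN exprVn.
  have xn0 : x != 0 by rewrite gt_eqF.
  have dV := is_deriveV xn0 (is_derive_id x (1 : R)).
  have dp := @is_derive1_comp R (horner p) _ x _ _ (is_derive_poly p _) dV.
  have dE := @is_derive1_comp R expR _ x _ _ (is_derive_expR _) (is_deriveN dV).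
  apply: (is_derive_eq (is_deriveM dp dE)).
  by rewrite /GRing.scale /=; field.
- have [C C0 hC] := flat_sqr_bound p.
  by rewrite [X in is_derive _ _ _ X]/flat ltxx; exact: is_derive0_sqr_bound hC.
Unshelve. all: by end_near. Qed.

Lemma smooth1_flat p : smooth1 (flat p).
Proof.
move=> n; elim: n p => [p|n IHn p]; first exact: is_derive_continuous (is_derive_flat p).
by exists (flat ('X ^+ 2 * (p - p^`()))) => //; exact: is_derive_flat.
Qed.
End smooth_line.

(** * Test functions in product form *)
Section tensor.
Context (R : realType).
Implicit Types (u v : R -> R).

Definition tensor u v (x : plane R) : R := u x.1 * v x.2.

Definition bump u := smooth1 u /\ exists M : R, forall x, u x != 0 -> `|x| <= M.

Lemma continuous_tensor u v : continuous u -> continuous v -> continuous (tensor u v).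
Proof.
move=> cu cv x; apply: cvgM.
  by apply: (@continuous_comp _ _ _ fst u); [exact: cvg_fst|exact: cu].
by apply: (@continuous_comp _ _ _ snd v); [exact: cvg_snd|exact: cv].
Qed.

Lemma is_derive_tensor i u v x : smooth1 u -> smooth1 v ->
  is_derive x (ebasis R i) (tensor u v)
    ((if i == ord0 then tensor (derive1 u) v else tensor u (derive1 v)) x).
Proof.
move=> su sv.
have quotient f (y l : R) : is_derive y (1 : R) f l ->
    h^-1 *: (f (h + y) - f y) @[h --> 0^'] --> l.
  move=> [df <-]; move: (df); rewrite /derivable /derive.
  rewrite (_ : (fun h => _) = fun h => h^-1 *: (f (h + y) - f y))//.
  by apply/funext => h; rewrite /= [_%:A]mulr1.
suff h : h^-1 *: ((tensor u v \o shift x) (h *: ebasis R i) - tensor u v x)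
    @[h --> 0^'] --> (if i == ord0 then tensor (derive1 u) v else tensor u (derive1 v)) x.
  by apply: DeriveDef; [apply/cvg_ex; eexists; exact: h|exact/cvg_lim].
rewrite /ebasis; case: ifPn => _.
- rewrite (_ : (fun h => _) = fun h => h^-1 *: (u (h + x.1) - u x.1) * v x.2).
    exact: cvgM (quotient _ _ _ (smooth1_is_derive su x.1)) (cvg_cst (v x.2)).
  apply/funext => h; rewrite /tensor/=.
  by rewrite /GRing.scale /= !mulr1 mulr0 add0r -mulrA mulrBl.
- have q := quotient _ _ _ (smooth1_is_derive sv x.2).
  have {q} := @cvgM _ _ _ _ _ _ _ _ (cvg_cst (u x.1)) q.
  rewrite (_ : _ \* _ = fun h => h^-1 *: ((tensor u v \o shift x) (h *: (0, 1)) - tensor u v x)).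
    by move=> H; exact: H.
  apply/funext => h; rewrite /tensor/=.
  by rewrite /GRing.scale /= !mulr1 mulr0 add0r mulrCA mulrBr.
Qed.

Lemma partial_tensor i u v : smooth1 u -> smooth1 v ->
  partial i (tensor u v) =
    if i == ord0 then tensor (derive1 u) v else tensor u (derive1 v).
Proof.
move=> su sv; apply/funext => x; rewrite /partial.
exact: (@derive_val _ _ _ _ _ _ _ (is_derive_tensor i x su sv)).
Qed.

(** A partial derivative of a product u(x1) v(x2) differentiates one of the two
    factors, so all the iterated ones have the same form. *)
Lemma smooth_tensor u v : smooth1 u -> smooth1 v -> smooth (tensor u v).
Proof.
move=> su sv s.
have [u' [v' [su' [sv' ->]]]] : exists u' v', smooth1 u' /\ smooth1 v' /\
    iter_partial s (tensor u v) = tensor u' v'.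
  elim: s => [|i s [u' [v' [su' [sv' IH]]]]] /=; first by exists u, v.
  rewrite IH partial_tensor//; case: ifPn => _.
  - by exists (derive1 u'), v'; split => //; exact: smooth1_derive1.
  - by exists u', (derive1 v'); split => //; split => //; exact: smooth1_derive1.
split; first by apply: continuous_tensor; exact: smooth1_continuous.
by move=> i x; case: (is_derive_tensor i x su' sv').
Qed.

Lemma test_function_tensor u v : bump u -> bump v -> test_function (tensor u v).
Proof.
move=> [su [M hu]] [sv [N hv]]; split; first exact: smooth_tensor.
have cpt : compact (`[- M, M]%classic `*` `[- N, N]%classic : set (plane R)).
  by apply: compact_setX; exact: segment_compact.
apply: (subclosed_compact _ cpt); first exact: closed_closure.
rewrite [X in _ `<=` X](closure_id _).1; last first.
  by apply: compact_closed cpt; exact: norm_hausdorff.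
apply: closure_subset => -[x y] /=; rewrite /tensor/= mulf_eq0 negb_or => /andP[ux vy].
by split; rewrite /= in_itv/= -ler_norml; [exact: hu|exact: hv].
Qed.

Lemma bump_shift u c : bump u -> bump (fun x => u (x - c)).
Proof.
move=> [su [M hu]]; split.
  rewrite (_ : (fun x => _) = fun x => u (1 * x + - c)); first exact: smooth1_affine.
  by apply/funext => x; rewrite mul1r.
exists (M + `|c|) => x /hu h; rewrite -(subrK c x) (le_trans (ler_normD _ _))//.
by rewrite lerD2r.
Qed.

Lemma derive1_shift u c x : smooth1 u -> derive1 (fun x => u (x - c)) x = derive1 u (x - c).
Proof.
move=> su.
have dc : is_derive x (1 : R) (fun y : R => y - c) 1.
  have h := is_deriveB (is_derive_id x (1 : R)) (is_derive_cst c x (1 : R)).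
  by apply: (is_derive_eq h); rewrite subr0.
have := @is_derive1_comp R u (fun y : R => y - c) x _ _ (smooth1_is_derive su _) dc.
by case=> _ h; rewrite derive1E [LHS]h mulr1.
Qed.

Lemma bump_bounded u : bump u -> exists2 C : R, 0 <= C & forall x, `|u x| <= C.
Proof.
move=> [su [M hu]].
have [C [_ hC]] : bounded_set (u @` `[- M, M]%classic).
  apply: compact_bounded; apply: continuous_compact; last exact: segment_compact.
  by apply: continuous_subspaceT; exact: smooth1_continuous.
exists (`|C| + 1) => [|x]; first by rewrite addr_ge0.
have [->|ux] := eqVneq (u x) 0; first by rewrite normr0 addr_ge0.
apply: (hC (`|C| + 1)); first by rewrite (le_lt_trans (ler_norm C))// ltrDl.
by exists x => //; rewrite /= in_itv/= -ler_norml hu.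
Qed.

Lemma bump_derive1 u : bump u -> bump (derive1 u).
Proof.
move=> [su [M hu]]; split; first exact: smooth1_derive1.
exists M => x; apply: contraNT; rewrite -ltNge => xM; apply/eqP.
have d0 : is_derive x (1 : R) u 0.
  apply: (@near_eq_is_derive _ _ _ (cst 0)).
  have : \forall y \near x, M < `|y|.
    exact: (@cvgr_gt R R (nbhs x) _ Num.norm `|x| (@norm_continuous _ R x) M xM).
  apply: filterS => y yM; apply/esym/eqP; apply: contraLR yM => uy.
  by rewrite -leNgt; exact: hu.
by rewrite derive1E; exact: derive_val.
Qed.

Lemma measurable_bump u : bump u -> measurable_fun [set: R] u.
Proof. by move=> [su _]; apply: continuous_measurable_fun; exact: smooth1_continuous. Qed.

End tensor.

(** * The fundamental lemma of the calculus of variations *)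
Section indicator_approximation.
Context (R : realType).
Implicit Types (a b : R).

(** As n grows, exp(-1/(n s)) tends to 1 for every s > 0, so the product of the
    two one-sided factors tends to 1 on ]a, b[; it vanishes elsewhere. *)
Definition plateau a b (n : nat) (t : R) : R :=
  flat 1 (n.+1%:R * (t - a)) * flat 1 (n.+1%:R * (b - t)).

Lemma flat1_itv (t : R) : 0 <= flat 1 t <= 1.
Proof.
rewrite /flat; case: ifPn => t0; last by rewrite lexx ler01.
by rewrite hornerC mul1r expR_ge0/= -expR0 ler_expR oppr_le0 invr_ge0 ltW.
Qed.

Lemma plateau_itv a b n t : 0 <= plateau a b n t <= 1.
Proof.
have /andP[h1 h2] := flat1_itv (n.+1%:R * (t - a)).
have /andP[h3 h4] := flat1_itv (n.+1%:R * (b - t)).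
by rewrite mulr_ge0//= mulr_ile1.
Qed.

Lemma plateau_out a b n t : t \notin `]a, b[ -> plateau a b n t = 0.
Proof.
rewrite in_itv/= negb_and -!leNgt /plateau /flat !pmulr_rgt0 ?ltr0n// !subr_gt0.
by case/orP => h; [rewrite (ltNge a) h mul0r|rewrite (ltNge t) h mulr0].
Qed.

Lemma bump_plateau a b n : bump (plateau a b n).
Proof.
split; last first.
  exists (`|a| + `|b|) => t; apply: contraNT => h; apply/eqP/plateau_out.
  apply: contra h; rewrite in_itv/= => /andP[at_ tb].
  rewrite ler_norml; have := ler_norm b; have := ler_norm (- a); rewrite normrN.
  have := normr_ge0 a; have := normr_ge0 b.
  by move=> ? ? ? ?; apply/andP; split; lra.
apply: smooth1M.
- rewrite (_ : (fun x => _) = fun x => flat 1 (n.+1%:R * x + (- (n.+1%:R * a)))).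
    by apply: smooth1_affine; exact: smooth1_flat.
  by apply/funext => x; rewrite mulrBr.
- rewrite (_ : (fun x => _) = fun x => flat 1 (- n.+1%:R * x + n.+1%:R * b)).
    by apply: smooth1_affine; exact: smooth1_flat.
  by apply/funext => x; congr flat; ring.
Qed.

Lemma flat1_cvg (t : R) : 0 < t -> flat 1 (n.+1%:R * t) @[n --> \oo] --> (1 : R).
Proof.
move=> t0.
rewrite (_ : (fun n => _) = fun n => expR (- (harmonic n * t^-1))); last first.
  by apply/funext => n; rewrite /flat pmulr_rgt0 ?t0 ?ltr0n// hornerC mul1r invfM.
have h : - (harmonic n * t^-1) @[n --> \oo] --> (0 : R).
  rewrite -oppr0 -(mul0r t^-1); apply: cvgN.
  by apply: cvgM; [exact: cvg_harmonic|exact: cvg_cst].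
rewrite -[X in _ --> X]expR0.
by apply: continuous_cvg h; exact: continuous_expR.
Qed.

Lemma plateau_cvg a b t :
  plateau a b n t @[n --> \oo] --> (\1_(`]a, b[%classic) t : R).
Proof.
rewrite indicE; case: (boolP (t \in `]a, b[)) => tab.
  rewrite mem_set//; move: tab; rewrite in_itv/= => /andP[at_ tb].
  rewrite -[X in _ --> X]mulr1.
  by apply: cvgM; apply: flat1_cvg; rewrite subr_gt0.
rewrite memNset; last exact/negP.
rewrite (_ : (fun n => _) = cst 0); first exact: cvg_cst.
by apply/funext => n; rewrite plateau_out.
Qed.
End indicator_approximation.

Section open_rectangles.
Context (R : realType).

Definition open_rectangle : set (set (mplane R)) :=
  [set A | exists a b c d : R, A = `]a, b[%classic `*` `]c, d[%classic].

Lemma measurable_open_rectangle A : open_rectangle A -> measurable A.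
Proof. by move=> [a [b [c [d ->]]]]; apply: measurableX; exact: measurable_itv. Qed.

Lemma open_rectangle_box n : open_rectangle (@box R n).
Proof. by exists (- n%:R), n%:R, (- n%:R), n%:R. Qed.

Lemma itv_ooI (a b a' b' : R) :
  `]a, b[%classic `&` `]a', b'[%classic = `]Num.max a a', Num.min b b'[%classic :> set R.
Proof.
apply/seteqP; split => x /=; rewrite !in_itv/= gt_max lt_min.
  by move=> [/andP[-> ->] /andP[-> ->]].
by move=> /andP[/andP[-> ->] /andP[-> ->]].
Qed.

Lemma setI_closed_open_rectangle : setI_closed open_rectangle.
Proof.
move=> _ _ [a [b [c [d ->]]]] [a' [b' [c' [d' ->]]]].
exists (Num.max a a'), (Num.min b b'), (Num.max c c'), (Num.min d d').
by rewrite -setXI !itv_ooI.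
Qed.

(** Both projections are measurable for the sigma-algebra generated by the open
    rectangles, because a strip over an open interval is a countable union of
    them; hence so is the identity map into the product. *)
Lemma measurable_planeE : @measurable _ (mplane R) = <<s open_rectangle >>.
Proof.
apply/seteqP; split; last first.
  apply: smallest_sub; first exact: sigma_algebra_measurable.
  by move=> A /measurable_open_rectangle.
pose T0 := g_sigma_algebraType open_rectangle.
have mRE : @measurable _ (line R) = <<s @RGenOpens.G R >>.
  exact: RGenOpens.measurableE.
have m1 : measurable_fun [set: T0] (fst : T0 -> line R).
  apply: (@measurability _ _ T0 (line R) setT fst _ mRE) => _ [_ [x [y ->]] <-]; rewrite setTI.
  rewrite (_ : _ @^-1` _ = \bigcup_n (`]x, y[%classic `*` `](- n%:R), n%:R[%classic)).
    apply: bigcupT_measurable => n; apply: sub_sigma_algebra.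
    by exists x, y, (- n%:R), n%:R.
  apply/seteqP; split => [[p q]/= pxy|[p q] [n _ []//]].
  exists (Num.bound q) => //; split => //=.
  by rewrite in_itv/= -ltr_norml unstable.ltr_norm_bound.
have m2 : measurable_fun [set: T0] (snd : T0 -> line R).
  apply: (@measurability _ _ T0 (line R) setT snd _ mRE) => _ [_ [x [y ->]] <-]; rewrite setTI.
  rewrite (_ : _ @^-1` _ = \bigcup_n (`](- n%:R), n%:R[%classic `*` `]x, y[%classic)).
    apply: bigcupT_measurable => n; apply: sub_sigma_algebra.
    by exists (- n%:R), n%:R, x, y.
  apply/seteqP; split => [[p q]/= qxy|[p q] [n _ []//]].
  exists (Num.bound p) => //; split => //=.
  by rewrite in_itv/= -ltr_norml unstable.ltr_norm_bound.
have mid : measurable_fun [set: T0] (idfun : T0 -> mplane R).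
  by apply/measurable_fun_pairP; split.
by move=> A mA; have := mid measurableT A mA; rewrite setTI.
Qed.

End open_rectangles.

Section fundamental_lemma.
Context (R : realType).
Variable g : mplane R -> R.
Hypothesis mg : measurable_fun [set: mplane R] g.
Hypothesis locg : forall n, (leb2 R).-integrable (@box R n) (EFin \o g).
Hypothesis g_test : forall u v, bump u -> bump v ->
  (\int[leb2 R]_x (g x * tensor u v x)%:E = 0)%E.
Local Open Scope ereal_scope.

Lemma rectangle_sub_box (a b c d : R) :
  exists n, `]a, b[%classic `*` `]c, d[%classic `<=` @box R n.
Proof.
exists (Num.bound (`|a| + `|b| + `|c| + `|d|)%R).
have := unstable.ltr_bound (`|a| + `|b| + `|c| + `|d|)%R.
set N := _%:R => hN.
move=> -[x y] [/=]; rewrite !in_itv/= => /andP[ax xb] /andP[cy yd].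
have := (ler_norm b, ler_norm d, ler_norm (- a)%R, ler_norm (- c)%R).
rewrite !normrN => -[[[h1 h2] h3] h4].
have := (normr_ge0 a, normr_ge0 b, normr_ge0 c, normr_ge0 d).
move=> [[[p1 p2] p3] p4].
by split; rewrite /= in_itv/= -/N; apply/andP; split; lra.
Qed.

(** Dominated convergence along the plateau functions of the two sides of the
    rectangle. *)
Lemma integral_rectangle0 Q : open_rectangle Q -> \int[leb2 R]_(x in Q) (g x)%:E = 0.
Proof.
move=> oQ; have mQ := measurable_open_rectangle oQ; move: oQ.
move=> [a [b [c [d QE]]]].
have gQ : (leb2 R).-integrable setT ((EFin \o g) \_ Q).
  apply: (integrable_mkcond (EFin \o g) mQ).1.
  have [n Qn] := rectangle_sub_box a b c d.
  rewrite -QE in Qn.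
  exact: (integrableS (@measurable_box R n) mQ Qn (locg n)).
pose f_ n (x : mplane R) := (g x * tensor (plateau a b n) (plateau c d n) x)%:E.
rewrite integral_mkcond.
have mtensor n : measurable_fun [set: mplane R] (tensor (plateau a b n) (plateau c d n)).
  apply: measurable_funM.
    apply: (measurableT_comp (measurable_bump (bump_plateau a b n))).
    exact: measurable_plane_fst.
  apply: (measurableT_comp (measurable_bump (bump_plateau c d n))).
  exact: measurable_plane_snd.
have [_ _ cv] : [/\ (leb2 R).-integrable setT ((EFin \o g) \_ Q),
  [sequence \int[leb2 R]_x `|f_ n x - ((EFin \o g) \_ Q) x|]_n @ \oo --> 0 &
  [sequence \int[leb2 R]_x f_ n x]_n @ \oo --> \int[leb2 R]_x (((EFin \o g) \_ Q) x)].
  apply: (@dominated_convergence _ _ _ _ _ measurableT f_ _ (abse \o ((EFin \o g) \_ Q))) => //.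
  - by move=> n; apply/measurable_EFinP; apply: measurable_funM.
  - exact: measurable_int gQ.
  - apply/aeW => -[x y] _.
    have -> : ((EFin \o g) \_ Q) (x, y) =
        (g (x, y) * (\1_(`]a, b[%classic) x * \1_(`]c, d[%classic) y))%:E.
      rewrite patchE QE !indicE in_setX/=.
      by case: (x \in _); case: (y \in _) => /=; rewrite ?(mulr0, mul0r, mulr1).
    apply: cvg_EFin; first by apply: nearW.
    apply: cvgM; first exact: cvg_cst.
    by apply: cvgM; exact: plateau_cvg.
  - exact: integrable_abse.
  - apply/aeW => -[x y] n _; rewrite /f_ /tensor/= patchE QE in_setX/=.
    have /andP[p0 p1] := plateau_itv a b n x.
    have /andP[q0 q1] := plateau_itv c d n y.
    have [xab|xab] := boolP (x \in `]a, b[); last first.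
      by rewrite (plateau_out _ xab) mul0r mulr0 normr0 /= abse_ge0.
    have [ycd|ycd] := boolP (y \in `]c, d[); last first.
      by rewrite (plateau_out _ ycd) !mulr0 normr0 /= abse_ge0.
    rewrite !mem_set//= lee_fin normrM ler_piMr//.
    by rewrite ger0_norm; [exact: mulr_ile1|exact: mulr_ge0].
move: cv; rewrite (_ : [sequence _]_n = cst 0).
  by move/cvg_lim => <- //; rewrite lim_cst.
by apply/funext => n; rewrite /= g_test//; exact: bump_plateau.
Qed.

(** A pi-lambda argument, inside a fixed box because g is only locally
    integrable. *)
Lemma integral_subbox0 n (E : set (mplane R)) : measurable E ->
  \int[leb2 R]_(x in E `&` box n) (g x)%:E = 0.
Proof.
have mb := @measurable_box R n.
rewrite measurable_planeE; move: E.
apply: (dynkin_induction (measurable_planeE R) (@setI_closed_open_rectangle R)).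
- by rewrite setTI; apply: integral_rectangle0; exact: open_rectangle_box.
- move=> A oA; apply: integral_rectangle0.
  by apply: setI_closed_open_rectangle => //; exact: open_rectangle_box.
- move=> A mA A0; have mAb := measurableI _ _ mA mb.
  have mCAb := measurableI _ _ (measurableC mA) mb.
  have : \int[leb2 R]_(x in box n) (g x)%:E = 0.
    by apply: integral_rectangle0; exact: open_rectangle_box.
  rewrite [X in \int[_]_(x in X) _](_ : _ = (A `&` box n) `|` (~` A `&` box n)); last first.
    by rewrite -setIUl setUv setTI.
  rewrite integral_setU//=; last 2 first.
  - exact/measurable_EFinP/measurable_funTS.
  - by apply/disj_setPS => x [[Ax _] [nAx _]].
  by rewrite A0 add0e.
- move=> F mF tF F0; rewrite setI_bigcupl integral_bigcup//.
  + by rewrite eseries0.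
  + exact: trivIset_setIr.
  + by move=> k; exact: measurableI.
  + apply: integrableS (locg n) => //.
      by apply: bigcup_measurable => k _; exact: measurableI.
    by move=> x [k _ []].
Qed.

Lemma ae_eq0_of_test_functions : {ae leb2 R, forall x, g x = 0%R}.
Proof.
have h n : {ae leb2 R, forall x, box n x -> (g x)%:E = 0}.
  apply: (@integral_ae_eq _ _ _ (leb2 R) _ (@measurable_box R n) (cst 0) (EFin \o g)) => //.
  move=> E Eb mE; rewrite -(setIidl Eb) integral_subbox0//.
  by rewrite integral_cst ?mul0e//; apply: measurableI => //; exact: measurable_box.
have /ae_foralln := h; apply: filterS => x hx.
have [n _ bx] : (\bigcup_n @box R n) x by rewrite bigcup_box.
by have [] := hx n bx.
Qed.

End fundamental_lemma.

(** * Square-integrable functions and averages over segments *)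
Section parametric.
Context d1 d2 (T1 : measurableType d1) (T2 : measurableType d2) (R : realType).
Variable m : {sigma_finite_measure set T2 -> \bar R}.

(** Tonelli yields measurability for the positive and negative parts, and the
    difference of the two integrals is the integral by definition, be it finite
    or not. *)
Lemma measurable_integral_param (f : T1 -> T2 -> \bar R) :
  measurable_fun [set: T1 * T2] (fun p => f p.1 p.2) ->
  measurable_fun [set: T1] (fun x => \int[m]_t f x t)%E.
Proof.
move=> mf.
rewrite (_ : (fun x => _) = fun x =>
   (\int[m]_t ((fun p : T1 * T2 => f p.1 p.2)^\+ (x, t)) -
    \int[m]_t ((fun p : T1 * T2 => f p.1 p.2)^\- (x, t)))%E).
  apply: emeasurable_funB.
  - exact: (measurable_fun_fubini_tonelli_F (m2 := m) _ (measurable_funepos mf)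
      (fun p => funepos_ge0 _ p)).
  - exact: (measurable_fun_fubini_tonelli_F (m2 := m) _ (measurable_funeneg mf)
      (fun p => funeneg_ge0 _ p)).
apply/funext => x; rewrite [LHS]integralE; congr (_ - _)%E.
  by apply: eq_integral => t _; rewrite !funeposE.
by apply: eq_integral => t _; rewrite !funenegE.
Qed.

Lemma measurable_integral_param_in (D : set T2) (f : T1 -> T2 -> \bar R) :
  measurable D -> measurable_fun [set: T1 * T2] (fun p => f p.1 p.2) ->
  measurable_fun [set: T1] (fun x => \int[m]_(t in D) f x t)%E.
Proof.
move=> mD mf.
rewrite (_ : (fun x => _) = fun x => \int[m]_t (f x \_ D) t)%E; last first.
  by apply/funext => x; rewrite integral_mkcond.
apply: measurable_integral_param.
rewrite (_ : (fun p => _) = (fun p : T1 * T2 => f p.1 p.2) \_ (setT `*` D)); last first.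
  by apply/funext => -[x t]; rewrite !patchE in_setX in_setT.
apply/(measurable_restrictT _ _).1; first exact: measurableX.
exact: measurable_funTS.
Qed.

End parametric.

Section square_integrable.
Context (R : realType).
Implicit Types (f g : mplane R -> R) (h : plane R).
Local Open Scope ereal_scope.

Definition sqint f := measurable_fun [set: mplane R] f /\
  \int[leb2 R]_x (f x ^+ 2)%:E < +oo.

Lemma sqint_L2 f : L2 f -> sqint f.
Proof.
move=> fL2; have i2 := Lfun2_integrable_sqr fL2.
split; first by move: fL2; rewrite /L2 inE => /andP[]; rewrite inE.
have /integrableP[_] := i2.
by under eq_integral do rewrite gee0_abs ?lee_fin ?sqr_ge0//.
Qed.

Lemma measurable_shift_plane h :
  measurable_fun [set: mplane R] (fun x : mplane R => ((x : plane R) + h)%R : mplane R).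
Proof. exact: measurable_fun_planeD. Qed.

Lemma sqint_shift f h : sqint f -> sqint (fun x => f (x + h)%R).
Proof.
move=> [mf foo]; split.
  exact: (measurableT_comp mf (measurable_shift_plane h)).
rewrite (integral_plane_shift h (f := fun x => (f x ^+ 2)%:E))//.
by apply/measurable_EFinP; exact: measurable_funX.
Qed.

Lemma sqintZ (c : R) f : sqint f -> sqint (fun x => c * f x)%R.
Proof.
move=> [mf foo]; split; first exact: measurable_funM.
under eq_integral do rewrite exprMn EFinM.
rewrite ge0_integralZl_EFin ?sqr_ge0//.
- by rewrite lte_mul_pinfty ?lee_fin ?sqr_ge0.
- by move=> x _; rewrite lee_fin sqr_ge0.
- by apply/measurable_EFinP; exact: measurable_funX.
Qed.

Lemma sqintD f g : sqint f -> sqint g -> sqint (fun x => f x + g x)%R.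
Proof.
move=> [mf foo] [mg goo]; split; first exact: measurable_funD.
have mf2 : measurable_fun [set: mplane R] (fun x => (f x ^+ 2)%:E).
  by apply/measurable_EFinP; exact: measurable_funX.
have mg2 : measurable_fun [set: mplane R] (fun x => (g x ^+ 2)%:E).
  by apply/measurable_EFinP; exact: measurable_funX.
apply: (@le_lt_trans _ _ (\int[leb2 R]_x (2%:E * ((f x ^+ 2)%:E + (g x ^+ 2)%:E)))).
  apply: ge0_le_integral => //.
  - by move=> x _; rewrite lee_fin sqr_ge0.
  - by apply/measurable_EFinP; apply: measurable_funX; exact: measurable_funD.
  - by apply: measurable_funeM; exact: emeasurable_funD.
  - move=> x _; rewrite -EFinD -EFinM lee_fin.
    have := sqr_ge0 (f x - g x)%R; rewrite sqrrB sqrrD; lra.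
rewrite ge0_integralZl_EFin//; last 2 first.
- by move=> x _; rewrite -EFinD lee_fin addr_ge0// sqr_ge0.
- exact: emeasurable_funD.
rewrite ge0_integralD//; last 2 first.
- by move=> x _; rewrite lee_fin sqr_ge0.
- by move=> x _; rewrite lee_fin sqr_ge0.
by rewrite lte_mul_pinfty// lte_add_pinfty.
Qed.

Lemma sqint_integrable f (D : set (mplane R)) : sqint f -> measurable D -> leb2 R D < +oo ->
  (leb2 R).-integrable D (EFin \o f).
Proof.
move=> [mf foo] mD Doo; apply: integrable_sqr => //; first exact: measurable_funTS.
apply: le_lt_trans foo; apply: ge0_subset_integral => //.
- by apply/measurable_EFinP; exact: measurable_funX.
- by move=> x _; rewrite lee_fin sqr_ge0.
Qed.

Definition unit_itv : set (line R) := `[0%R, 1%R]%classic.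

Lemma measurable_unit_itv : measurable unit_itv.
Proof. exact: measurable_itv. Qed.

Lemma leb_unit_itv : leb unit_itv = 1.
Proof. by rewrite /unit_itv lebesgue_measure_itv/= lte_fin ltr01 oppr0 adde0. Qed.

(** The average of f over the segment from x to x + h. *)
Definition ray f h (x : plane R) : R :=
  (\int[leb]_(t in unit_itv) f (x + t *: h))%R.

Lemma measurable_ray_map h : measurable_fun [set: mplane R * line R]
  (fun p : mplane R * line R => ((p.1 : plane R) + (p.2 : R) *: h)%R : mplane R).
Proof.
apply: measurable_fun_planeD; first exact: (@measurable_fst _ _ (mplane R) (line R)).
apply: (@measurable_fun_planeZ R _ _ (fun p : mplane R * line R => p.2 : R) (fun=> h : mplane R)) => //.
exact: (@measurable_snd _ _ (mplane R) (line R)).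
Qed.

Lemma measurable_ray_section h (x : plane R) : measurable_fun [set: line R]
  (fun t : line R => ((x : plane R) + (t : R) *: h)%R : mplane R).
Proof. by apply: (measurable_fun_pair2 (x : mplane R) (measurable_ray_map h)). Qed.

Lemma leb2_itv_swap (D : set (line R)) (f : mplane R -> line R -> \bar R) :
  measurable D -> measurable_fun [set: mplane R * line R] (fun p => f p.1 p.2) ->
  (forall x t, 0 <= f x t) ->
  \int[leb2 R]_x \int[leb]_(t in D) f x t = \int[leb]_(t in D) \int[leb2 R]_x f x t.
Proof.
move=> mD mf f0.
rewrite [RHS]integral_mkcond.
transitivity (\int[leb2 R]_x \int[leb]_t (f x \_ D) t).
  by apply: eq_integral => x _; rewrite integral_mkcond.
rewrite (@leb2_leb_swap R (fun x => f x \_ D)).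
- apply: eq_integral => t _; rewrite patchE; case: ifPn => tD.
    by apply: eq_integral => x _; rewrite patchE tD.
  rewrite integral0_eq// => x _.
  by rewrite patchE (negbTE tD).
- rewrite (_ : (fun p => _) = (fun p : mplane R * line R => f p.1 p.2) \_ (setT `*` D)).
    apply/(measurable_restrictT _ _).1; first exact: measurableX.
    exact: measurable_funTS.
  by apply/funext => -[x t]; rewrite !patchE in_setX in_setT.
- by move=> x t; rewrite patchE; case: ifP.
Qed.

(** For each t the integral in x is invariant under the shift by t h, and the
    parameter t ranges over an interval of length 1. *)
Lemma integral_ray h (G : mplane R -> \bar R) :
  measurable_fun [set: mplane R] G -> (forall x, 0 <= G x) ->
  \int[leb2 R]_x \int[leb]_(t in unit_itv) G (x + t *: h)%R = \int[leb2 R]_x G x.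
Proof.
move=> mG G0.
rewrite (@leb2_itv_swap unit_itv (fun x t => G ((x : plane R) + (t : R) *: h)%R))//.
- transitivity (\int[leb]_(t in unit_itv) cst (\int[leb2 R]_x G x) t).
    by apply: eq_integral => t _; rewrite integral_plane_shift.
  rewrite (integral_cst _ measurable_unit_itv).
  by rewrite [X in _ * X](leb_unit_itv) mule1.
- exact: measurable_unit_itv.
- exact: (measurableT_comp mG (measurable_ray_map h)).
Qed.

Lemma sqr_ray f h (x : plane R) : measurable_fun [set: mplane R] f ->
  (ray f h x ^+ 2)%:E <= \int[leb]_(t in unit_itv) (f (x + t *: h)%R ^+ 2)%:E.
Proof.
move=> mf; set J := (X in _ <= X).
have -> : J = leb unit_itv * J by rewrite leb_unit_itv mul1e.
have l0 : 0 < leb unit_itv by rewrite leb_unit_itv.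
have loo : leb unit_itv < +oo by rewrite leb_unit_itv ltry.
apply: (sqr_Rintegral_le measurable_unit_itv l0 loo).
by apply: measurable_funTS; exact: (measurableT_comp mf (measurable_ray_section h x)).
Qed.

Lemma measurable_integral_ray h (G : mplane R -> \bar R) :
  measurable_fun [set: mplane R] G ->
  measurable_fun [set: mplane R]
    (fun x : mplane R => \int[leb]_(t in unit_itv) G ((x : plane R) + (t : R) *: h)%R).
Proof.
move=> mG; pose m : {sigma_finite_measure set (line R) -> \bar R} := @lebesgue_measure R.
apply: (measurable_integral_param_in m (f := fun x t => G ((x : plane R) + (t : R) *: h)%R)).
  exact: measurable_unit_itv.
exact: (measurableT_comp mG (measurable_ray_map h)).
Qed.

Lemma measurable_ray f h : measurable_fun [set: mplane R] f ->
  measurable_fun [set: mplane R] (ray f h).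
Proof.
move=> mf; have mf' : measurable_fun [set: mplane R] (EFin \o f).
  exact/measurable_EFinP.
exact: (measurableT_comp _ (measurable_integral_ray h mf')).
Qed.

Lemma measurable_sqr f : measurable_fun [set: mplane R] f ->
  measurable_fun [set: mplane R] (fun x => (f x ^+ 2)%:E).
Proof. by move=> mf; apply/measurable_EFinP; exact: measurable_funX. Qed.

Lemma sqint_ray f h : sqint f -> sqint (ray f h).
Proof.
move=> [mf foo]; split; first exact: measurable_ray.
have mf2 := measurable_sqr mf.
apply: le_lt_trans foo.
rewrite -(integral_ray h mf2); last by move=> x; rewrite lee_fin sqr_ge0.
apply: ge0_le_integral => //.
- by move=> x _; rewrite lee_fin sqr_ge0.
- by apply: measurable_sqr; exact: measurable_ray.
- exact: (measurable_integral_ray h mf2).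
- by move=> x _; exact: sqr_ray.
Qed.

(** The integral of f^2 along the segment has a finite integral in x, so it is
    finite for almost all x. *)
Lemma ray_integrable_ae f h : sqint f ->
  {ae leb2 R, forall x : mplane R,
     leb.-integrable unit_itv (fun t : line R => (f ((x : plane R) + (t : R) *: h)%R)%:E)}.
Proof.
move=> [mf foo]; have mf2 := measurable_sqr mf.
pose H (x : mplane R) := \int[leb]_(t in unit_itv) (f ((x : plane R) + (t : R) *: h)%R ^+ 2)%:E.
have H0 x : 0 <= H x by apply: integral_ge0 => t _; rewrite lee_fin sqr_ge0.
have iH : (leb2 R).-integrable setT H.
  apply/integrableP; split; first exact: (measurable_integral_ray h mf2).
  under eq_integral do rewrite gee0_abs//.
  by rewrite (integral_ray h mf2)// => x; rewrite lee_fin sqr_ge0.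
have := integrable_ae measurableT iH; apply: filterS => x /(_ I) Hfin.
apply: integrable_sqr.
- exact: measurable_unit_itv.
- by rewrite [X in X < _]leb_unit_itv ltry.
- by apply: measurable_funTS; exact: (measurableT_comp mf (measurable_ray_section h x)).
- by move: Hfin; rewrite ge0_fin_numE.
Qed.
End square_integrable.

(** * The pairing of square-integrable functions *)
Section pairing.
Context (R : realType).
Implicit Types (f g : mplane R -> R) (h : plane R).

Lemma sqint_tensor (u v : R -> R) : bump u -> bump v -> sqint (tensor u v).
Proof.
move=> bu bv.
have mt : measurable_fun [set: mplane R] (tensor u v).
  apply: measurable_funM.
    by apply: (measurableT_comp (measurable_bump bu)); exact: measurable_plane_fst.
  by apply: (measurableT_comp (measurable_bump bv)); exact: measurable_plane_snd.
split => //.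
have [Cu Cu0 hCu] := bump_bounded bu.
have [Cv Cv0 hCv] := bump_bounded bv.
have [_ [M hM]] := bu; have [_ [N hN]] := bv.
pose n := Num.bound (`|M| + `|N|).
have hn : `|M| + `|N| < n%:R by exact: unstable.ltr_bound.
pose K := (Cu * Cv) ^+ 2.
apply: (@le_lt_trans _ _ (\int[leb2 R]_(x in box n) (cst K%:E x))%E); last first.
  rewrite integral_cst; last exact: measurable_box.
  by rewrite lte_mul_pinfty ?lee_fin ?sqr_ge0// box_lty.
rewrite [leRHS]integral_mkcond; apply: ge0_le_integral => //.
- by move=> x _; rewrite lee_fin sqr_ge0.
- exact: measurable_sqr.
- by apply/(measurable_restrictT _ _).1 => //; exact: measurable_box.
- move=> [x y] _; rewrite patchE; case: ifPn => xyn.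
    rewrite lee_fin -real_normK ?num_real// ler_sqr ?nnegrE ?mulr_ge0//.
    by rewrite normrM ler_pM.
  rewrite lee_fin /tensor/=.
  have [->|ux] := eqVneq (u x) 0; first by rewrite mul0r expr0n.
  have [->|vy] := eqVneq (v y) 0; first by rewrite mulr0 expr0n.
  move: xyn; rewrite notin_setE; case; split; rewrite /= in_itv/= -ltr_norml.
    rewrite (le_lt_trans (hM _ ux))// (le_lt_trans _ hn)//.
    by rewrite (le_trans (ler_norm M))// lerDl.
  rewrite (le_lt_trans (hN _ vy))// (le_lt_trans _ hn)//.
  by rewrite (le_trans (ler_norm N))// lerDr.
Qed.

(** The product is dominated by the sum of the two squares. *)
Lemma sqintM_integrable f g : sqint f -> sqint g ->
  (leb2 R).-integrable setT (EFin \o (fun x => f x * g x)).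
Proof.
move=> [mf foo] [mg goo].
have i1 := integrable_sqrE mf foo; have i2 := integrable_sqrE mg goo.
apply: (le_integrable measurableT _ _ (integrableD measurableT i1 i2)).
  by apply/measurable_EFinP; exact: measurable_funM.
move=> x _.
rewrite -[leLHS]/((`|f x * g x|)%:E) -[leRHS]/((`|f x ^+ 2 + g x ^+ 2|)%:E) lee_fin.
rewrite [leRHS]ger0_norm ?addr_ge0 ?sqr_ge0//.
rewrite ler_norml; have := sqr_ge0 (f x - g x); have := sqr_ge0 (f x + g x).
have := sqr_ge0 (f x); have := sqr_ge0 (g x).
by rewrite sqrrB sqrrD => ? ? ? ?; apply/andP; split; lra.
Qed.

Definition pairing f g : R := \int[leb2 R]_x (f x * g x).

Lemma pairingC f g : pairing f g = pairing g f.
Proof. by apply: eq_Rintegral => x _; rewrite mulrC. Qed.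

Lemma pairingDl f1 f2 g : sqint f1 -> sqint f2 -> sqint g ->
  pairing (fun x => f1 x + f2 x) g = pairing f1 g + pairing f2 g.
Proof.
move=> s1 s2 sg; rewrite -RintegralD//; last 2 first.
- exact: sqintM_integrable.
- exact: sqintM_integrable.
by apply: eq_Rintegral => x _; rewrite mulrDl.
Qed.

Lemma pairingZl c f g : sqint f -> sqint g ->
  pairing (fun x => c * f x) g = c * pairing f g.
Proof.
move=> s1 sg; rewrite -RintegralZl//; last exact: sqintM_integrable.
by apply: eq_Rintegral => x _; rewrite mulrA.
Qed.

Lemma pairing_shift f g h : sqint f -> sqint g ->
  pairing f (fun x => g (x + h)) = pairing (fun x => f (x - h)) g.
Proof.
move=> [mf _] [mg _]; rewrite /pairing /Rintegral; congr fine.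
rewrite -(integral_plane_shift h (f := fun x => (f (x - h) * g x)%:E)).
  by apply: eq_integral => x _; rewrite addrK.
apply/measurable_EFinP; apply: measurable_funM => //.
exact: (measurableT_comp mf (measurable_shift_plane (- h))).
Qed.

(** Fubini; f(x) g(x + t h) is integrable in (x, t) because it is dominated by
    the sum of the two squares, which have finite integrals. *)
Lemma pairing_ray f g h : sqint f -> sqint g ->
  pairing f (ray g h) = \int[leb]_(t in @unit_itv R) pairing f (fun x => g (x + t *: h)).
Proof.
move=> sf sg; have [mf foo] := sf; have [mg goo] := sg.
pose m : {sigma_finite_measure set (line R) -> \bar R} := @lebesgue_measure R.
pose K (p : mplane R * line R) : \bar R :=
  (f p.1 * g ((p.1 : plane R) + (p.2 : R) *: h) * \1_(@unit_itv R) p.2)%:E.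
have mK : measurable_fun [set: mplane R * line R] K.
  apply/measurable_EFinP; apply: measurable_funM.
    apply: measurable_funM; last exact: (measurableT_comp mg (measurable_ray_map h)).
    by apply: measurableT_comp mf _; exact: (@measurable_fst _ _ (mplane R) (line R)).
  apply: measurableT_comp; last exact: (@measurable_snd _ _ (mplane R) (line R)).
  by apply: measurable_indic; exact: measurable_unit_itv.
have KE x : (fun t => K (x, t)) =
    (fun t : line R => (f x * g ((x : plane R) + (t : R) *: h))%:E) \_ (@unit_itv R).
  apply/funext => t; rewrite patchE /K/= indicE.
  by case: ifPn => _; rewrite ?mulr1 ?mulr0.
have iK : (plebesgue R \x m)%E.-integrable setT K.
  apply/integrable12ltyP => //.
  apply: (@le_lt_trans _ _ (\int[leb2 R]_x ((f x ^+ 2)%:E +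
     \int[leb]_(t in @unit_itv R) (g ((x : plane R) + (t : R) *: h) ^+ 2)%:E))%E).
    apply: ge0_le_integral => //.
    - by move=> x _; apply: integral_ge0.
    - apply: (measurable_integral_param m (f := fun x t => `|K (x, t)|%E)).
      exact: measurableT_comp.
    - apply: emeasurable_funD; first exact: measurable_sqr.
      exact: (measurable_integral_ray h (measurable_sqr mg)).
    move=> x _.
    have mgx : measurable_fun (@unit_itv R)
        (fun t : line R => (g ((x : plane R) + (t : R) *: h) ^+ 2)%:E).
      apply: measurable_funTS.
      exact: (measurableT_comp (measurable_sqr mg) (measurable_ray_section h x)).
    have -> : (f x ^+ 2)%:E = (\int[leb]_(t in @unit_itv R) cst (f x ^+ 2)%:E t)%E.
      rewrite (integral_cst _ (@measurable_unit_itv R)).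
      by rewrite [X in (_ * X)%E](@leb_unit_itv R) mule1.
    rewrite -ge0_integralD//; last 3 first.
    - exact: measurable_unit_itv.
    - by move=> t _; rewrite lee_fin sqr_ge0.
    - by move=> t _; rewrite lee_fin sqr_ge0.
    rewrite [leRHS]integral_mkcond; apply: ge0_le_integral => //.
    - by apply: measurableT_comp => //; exact: (measurable_fun_pair2 (x : mplane R) mK).
    - apply/(measurable_restrictT _ _).1; first exact: measurable_unit_itv.
      exact: emeasurable_funD.
    move=> t _; rewrite (congr1 (fun F => F t) (KE x)) !patchE.
    case: ifPn => _; last by rewrite abse0.
    rewrite -EFinD lee_fin ler_norml.
    move: (f x) (g _) => p q; have := sqr_ge0 (p - q); have := sqr_ge0 (p + q).
    have := sqr_ge0 p; have := sqr_ge0 q.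
    by rewrite sqrrB sqrrD => ? ? ? ?; apply/andP; split; lra.
  rewrite ge0_integralD//; last 4 first.
  - by move=> x _; rewrite lee_fin sqr_ge0.
  - exact: measurable_sqr.
  - by move=> x _; apply: integral_ge0 => t _; rewrite lee_fin sqr_ge0.
  - exact: (measurable_integral_ray h (measurable_sqr mg)).
  rewrite (integral_ray h (measurable_sqr mg)) => [|x]; last by rewrite lee_fin sqr_ge0.
  by rewrite lte_add_pinfty.
have := Fubini iK => F.
rewrite /pairing /Rintegral; congr fine.
transitivity (\int[leb2 R]_x \int[m]_t K (x, t))%E.
  apply: ae_eq_integral => //.
  - by apply/measurable_EFinP; apply: measurable_funM => //; exact: measurable_ray.
  - exact: (measurable_integral_param m (f := fun x t => K (x, t))).
  apply: filterS (ray_integrable_ae h sg) => x ix _.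
  rewrite KE -integral_mkcond.
  under eq_integral do rewrite EFinM.
  rewrite integralZl//; last exact: measurable_unit_itv.
  rewrite EFinM /ray /Rintegral fineK//.
  by apply: integrable_fin_num => //; exact: measurable_unit_itv.
rewrite F [RHS]integral_mkcond; apply: eq_integral => t _.
rewrite patchE; case: ifPn => tI.
  rewrite fineK; first by apply: eq_integral => x _; rewrite /K/= indicE tI mulr1.
  apply: integrable_fin_num => //; apply: sqintM_integrable => //.
  exact: sqint_shift.
rewrite integral0_eq// => x _.
by rewrite /K/= indicE (negbTE tI) mulr0.
Qed.
End pairing.

(** * Increments of a function with a weak gradient *)

(** When the integral diverges, in whatever way, the real-valued integral is 0
    on both sides. *)
Lemma RintegralN d (T : measurableType d) (R : realType)
    (mu : {measure set T -> \bar R}) (D : set T) (f : T -> R) :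
  \int[mu]_(x in D) (- f x) = - \int[mu]_(x in D) f x.
Proof.
rewrite /Rintegral integralE [in RHS]integralE.
have -> : (fun x => (- f x)%:E)^\+%E = (fun x => (f x)%:E)^\-%E.
  by rewrite -funeposN.
have -> : (fun x => (- f x)%:E)^\-%E = (fun x => (f x)%:E)^\+%E.
  by rewrite -funenegN.
have : (0 <= \int[mu]_(x in D) (fun x => (f x)%:E)^\+%E x)%E by exact: integral_ge0.
have : (0 <= \int[mu]_(x in D) (fun x => (f x)%:E)^\-%E x)%E by exact: integral_ge0.
case: (integral _ _ _) => [a| |] // a0; case: (integral _ _ _) => [b| |] // b0 /=; rewrite ?oppr0//.
by rewrite opprB.
Qed.

Section increments.
Context (R : realType).
Implicit Types (u v : R -> R) (h x : plane R).

(** The scalar product of h with the gradient of [tensor u v], and below with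
    the weak gradient DB. *)
Definition dtensor u v h x : R :=
  h.1 * tensor (derive1 u) v x + h.2 * tensor u (derive1 v) x.

(** The fundamental theorem of calculus along the segment from x to x - h. *)
Lemma ray_dtensor u v h x : smooth1 u -> smooth1 v ->
  ray (dtensor u v h) (- h) x = tensor u v x - tensor u v (x - h).
Proof.
move=> su sv.
pose F (t : R) := - (u (x.1 - t * h.1) * v (x.2 - t * h.2)).
have da (w : R -> R) (a b t : R) : smooth1 w ->
    is_derive t (1 : R) (fun t : R => w (a - t * b)) (- b * derive1 w (a - t * b)).
  move=> sw; have dl : is_derive t (1 : R) (fun t : R => a - t * b) (- b).
    have h0 := is_deriveB (is_derive_cst a t (1 : R)) (is_deriveZ b (is_derive_id t (1 : R))).
    rewrite (_ : (fun t => _) = (cst a - b \*: id)); last first.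
      by apply/funext => y /=; rewrite [RHS]/(a - b * y) mulrC.
    by apply: (is_derive_eq h0); rewrite /GRing.scale/= mulr1 sub0r.
  rewrite mulrC.
  exact: (@is_derive1_comp R w (fun t : R => a - t * b) t _ _ (smooth1_is_derive sw _) dl).
have dF (t : R) : is_derive t (1 : R) F (dtensor u v h (x + t *: - h)).
  have := is_deriveN (is_deriveM (da u x.1 h.1 t su) (da v x.2 h.2 t sv)).
  move=> dF0; apply: (is_derive_eq dF0).
  rewrite /dtensor /tensor/= /GRing.scale/= !mulrN.
  by ring.
have cF : continuous F by exact: is_derive_continuous dF.
have cf : continuous (fun t : R => dtensor u v h (x + t *: - h)).
  rewrite (_ : (fun t => _) = fun t =>
    h.1 * (derive1 u (x.1 - t * h.1) * v (x.2 - t * h.2)) +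
    h.2 * (u (x.1 - t * h.1) * derive1 v (x.2 - t * h.2))); last first.
    by apply/funext => t; rewrite /dtensor /tensor/= /GRing.scale/= !mulrN.
  have cw (w : R -> R) (a b : R) : smooth1 w -> continuous (fun t : R => w (a - t * b)).
    by move=> sw; apply: is_derive_continuous => t; exact: da.
  move=> t; apply: cvgD; (apply: cvgM; first exact: cvg_cst); apply: cvgM;
    by apply: cw => //; exact: smooth1_derive1.
rewrite /ray /Rintegral (@continuous_FTC2 R _ F 0 1) ?ltr01//.
- by rewrite /F/= /tensor !mul1r !mul0r !subr0 opprK addrC.
- exact: continuous_subspaceT.
- split.
  + by move=> t _; case: (dF t).
  + by apply: cvg_at_right_filter; exact: cF.
  + by apply: cvg_at_left_filter; exact: cF.
- by move=> t _; rewrite derive1E; case: (dF t).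
Qed.

Variables (B : plane R -> R) (DB : plane R -> plane R).
Hypotheses (BL2 : L2 B) (HDB : L2_gradient B DB).

Definition dgrad h x : R := h.1 * (DB x).1 + h.2 * (DB x).2.

Let sB : sqint B := sqint_L2 BL2.

Lemma sqint_grad i : sqint (fun x => Defs.coord i (DB x)).
Proof. by apply: sqint_L2; case: (HDB i). Qed.

Lemma sqint_dgrad h : sqint (dgrad h).
Proof.
by apply: sqintD; apply: sqintZ; [exact: (sqint_grad ord0)|exact: (sqint_grad (lift ord0 ord0))].
Qed.

Lemma sqint_dtensor u v h : bump u -> bump v -> sqint (dtensor u v h).
Proof.
by move=> bu bv; apply: sqintD; apply: sqintZ; apply: sqint_tensor => //; exact: bump_derive1.
Qed.

Lemma pairing_dtensor u v h : bump u -> bump v ->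
  pairing B (dtensor u v h) = - pairing (dgrad h) (tensor u v).
Proof.
move=> bu bv.
have [su _] := bu; have [sv _] := bv.
have st := sqint_tensor bu bv.
have s1 := sqint_tensor (bump_derive1 bu) bv.
have s2 := sqint_tensor bu (bump_derive1 bv).
have W i : pairing B (partial i (tensor u v)) = - pairing (fun x => Defs.coord i (DB x)) (tensor u v).
  by have [_] := HDB i; apply; exact: test_function_tensor.
have := W ord0; have := W (lift ord0 ord0); rewrite !partial_tensor//= => W2 W1.
rewrite pairingC /dtensor pairingDl//; [|exact: sqintZ..].
rewrite !pairingZl// [pairing _ B]pairingC W1 [pairing _ B]pairingC W2.
rewrite /dgrad pairingDl//; last 2 first.
- by apply: sqintZ; exact: (sqint_grad ord0).
- by apply: sqintZ; exact: (sqint_grad (lift ord0 ord0)).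
rewrite !pairingZl//; [|exact: (sqint_grad (lift ord0 ord0))|exact: (sqint_grad ord0)].
by rewrite opprD !mulrN.
Qed.

(** The difference g of the two sides is paired with a test function phi. By
    Fubini and translation, pairing the average of h . DB with phi amounts to
    averaging over t the pairings of h . DB with phi(. - t h); by definition of
    the weak gradient these are, up to sign, pairings of B with the derivative
    of phi along h at . - t h, whose average is phi - phi(. - h). *)
Lemma increment_ray h :
  {ae leb2 R, forall x : mplane R, B ((x : plane R) + h) - B x = ray (dgrad h) h x}.
Proof.
pose g (x : mplane R) := B ((x : plane R) + h) + (-1) * (B x + ray (dgrad h) h x).
have sBh : sqint (fun x => B (x + h)) := sqint_shift h sB.
have sr : sqint (ray (dgrad h) h) := sqint_ray h (sqint_dgrad h).
have sg : sqint g by apply: sqintD => //; apply: sqintZ; exact: sqintD.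
have : {ae leb2 R, forall x : mplane R, g x = 0}.
  apply: ae_eq0_of_test_functions.
  - by case: sg.
  - by move=> n; apply: sqint_integrable => //; [exact: measurable_box|exact: box_lty].
  move=> u v bu bv; have st := sqint_tensor bu bv.
  have [su _] := bu; have [sv _] := bv.
  have ig := sqintM_integrable sg st.
  suff g0 : pairing g (tensor u v) = 0.
    by rewrite -(fineK (integrable_fin_num measurableT ig)); congr (_%:E); exact: g0.
  rewrite (pairingDl sBh (sqintZ (-1) (sqintD sB sr)) st).
  rewrite (pairingZl (-1) (sqintD sB sr) st) (pairingDl sB sr st).
  have E1 : pairing B (ray (dtensor u v h) (- h)) = - pairing (ray (dgrad h) h) (tensor u v).
    rewrite (pairing_ray (- h) sB (sqint_dtensor h bu bv)).
    rewrite [pairing (ray _ _) _]pairingC (pairing_ray h st (sqint_dgrad h)).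
    rewrite -RintegralN; apply: eq_Rintegral => t _.
    rewrite (pairing_shift _ st (sqint_dgrad h)) [X in _ = - X]pairingC.
    pose us (y : R) : R := u (y - t * h.1); pose vs (y : R) : R := v (y - t * h.2).
    have bus : bump us by exact: bump_shift.
    have bvs : bump vs by exact: bump_shift.
    transitivity (pairing B (dtensor us vs h)).
      congr pairing; apply/funext => x.
      have dus : derive1 us x.1 = derive1 u (x.1 - t * h.1) by exact: derive1_shift.
      have dvs : derive1 vs x.2 = derive1 v (x.2 - t * h.2) by exact: derive1_shift.
      rewrite /dtensor /tensor dus dvs /us /vs/=.
      by rewrite /GRing.scale/= !mulrN.
    by rewrite pairing_dtensor.
  have E2 : pairing B (ray (dtensor u v h) (- h)) =
      pairing B (tensor u v) - pairing (fun x => B (x + h)) (tensor u v).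
    rewrite (_ : ray _ _ = fun x => tensor u v x + (-1) * tensor u v (x - h)).
      rewrite pairingC pairingDl//; last first.
        by apply: sqintZ; exact: sqint_shift.
      rewrite pairingZl//; last exact: sqint_shift.
      rewrite pairingC; congr (_ + _); rewrite mulN1r; congr (- _).
      by rewrite pairingC pairing_shift// opprK.
    by apply/funext => x; rewrite ray_dtensor// mulN1r.
  by move: E1; rewrite E2; lra.
apply: filterS => x; rewrite /g mulN1r opprD addrA => /eqP.
by rewrite subr_eq0 => /eqP.
Qed.
End increments.

(** * Bounded convex open sets of the plane *)
Section plane_sets.
Context (R : realType).
Implicit Types (U : set (plane R)) (x y : plane R).

Lemma open_rectangle_nbhs U x : open U -> U x ->
  exists2 e : R, 0 < e &
    `]x.1 - e, x.1 + e[%classic `*` `]x.2 - e, x.2 + e[%classic `<=` U.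
Proof.
move=> oU Ux; have /nbhs_ballP[e /= e0 eU] : nbhs x U by exact: open_nbhs_nbhs.
exists e => // -[a b] [/=]; rewrite !in_itv/= => ha hb; apply: eU.
by split; rewrite /= /ball/= distrC ltr_distl.
Qed.

(** The open set is the union of the rectangles with rational corners that it
    contains. *)
Lemma measurable_open_plane U : open U -> measurable (U : set (mplane R)).
Proof.
move=> oU.
pose Q (a b c d : rat) : set (mplane R) :=
  `]ratr a, ratr b[%classic `*` `]ratr c, ratr d[%classic.
pose P (a b c d : rat) : set (mplane R) := if `[< Q a b c d `<=` U >] then Q a b c d else set0.
have -> : U = \bigcup_a \bigcup_b \bigcup_c \bigcup_d P a b c d.
  apply/seteqP; split => [x Ux|x [a _ [b _ [c _ [d _]]]]]; last first.
    by rewrite /P; case: ifPn => // /asboolP; apply.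
  have [e e0 eU] := open_rectangle_nbhs oU Ux.
  have lt1 (r : R) : r - e < r by rewrite ltrBlDr ltrDl.
  have lt2 (r : R) : r < r + e by rewrite ltrDl.
  have [a /[!in_itv]/= /andP[a1 a2]] := rat_in_itvoo (lt1 x.1).
  have [b /[!in_itv]/= /andP[b1 b2]] := rat_in_itvoo (lt2 x.1).
  have [c /[!in_itv]/= /andP[c1 c2]] := rat_in_itvoo (lt1 x.2).
  have [d /[!in_itv]/= /andP[d1 d2]] := rat_in_itvoo (lt2 x.2).
  exists a => //; exists b => //; exists c => //; exists d => //.
  rewrite /P ifT; last first.
    apply/asboolP => -[p q] [/=]; rewrite !in_itv/= => /andP[p1 p2] /andP[q1 q2].
    apply: eU; split; rewrite /= in_itv/=; apply/andP; split.
    - exact: lt_trans p1.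
    - exact: lt_trans b2.
    - exact: lt_trans q1.
    - exact: lt_trans d2.
  by split; rewrite /= in_itv/= ?a2 ?b1 ?c2 ?d1.
apply: bigcupT_measurable_rat => a; apply: bigcupT_measurable_rat => b.
apply: bigcupT_measurable_rat => c; apply: bigcupT_measurable_rat => d.
rewrite /P; case: ifP => _; last exact: measurable0.
by apply: measurableX; exact: measurable_itv.
Qed.

Lemma bounded_plane U : bounded_set U ->
  exists2 M : R, 0 < M & forall x, U x -> `|x.1| < M /\ `|x.2| < M.
Proof.
move=> [M [_ hM]]; exists (`|M| + 2) => [|x Ux]; first by rewrite ltr_wpDl.
have := hM (`|M| + 1) _ x Ux.
have -> : M < `|M| + 1 by rewrite (le_lt_trans (ler_norm M))// ltrDl.
move=> /(_ isT); rewrite /Num.norm/= ge_max => /andP[h1 h2].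
have h : `|M| + 1 < `|M| + 2 by rewrite ltrD2l ltr1n.
by split; [exact: le_lt_trans h1 h|exact: le_lt_trans h2 h].
Qed.

Lemma leb2_bounded_lty U :
  measurable (U : set (mplane R)) -> bounded_set U -> (leb2 R U < +oo)%E.
Proof.
move=> mU /bounded_plane[M M0 hM].
apply: le_lt_trans (@box_lty R (Num.bound M)).
apply: le_measure; rewrite ?inE//; first exact: measurable_box.
have hn := unstable.ltr_bound M.
by move=> x /hM[h1 h2]; split; rewrite /= in_itv/= -ltr_norml (lt_trans _ hn).
Qed.

Lemma leb2_open_gt0 U x : open U -> U x -> (0 < leb2 R U)%E.
Proof.
move=> oU Ux; have [e e0 eU] := open_rectangle_nbhs oU Ux.
apply: (@lt_le_trans _ _ (leb2 R (`]x.1 - e, x.1 + e[%classic `*` `]x.2 - e, x.2 + e[%classic))).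
  rewrite leb2_rectangle; [|exact: measurable_itv|exact: measurable_itv].
  have l (r : R) : leb (`]r - e, r + e[%classic : set (line R)) = (r + e - (r - e))%:E.
    by rewrite leb_oo// lerBlDr -addrA lerDl addr_ge0// ltW.
  by rewrite !l -EFinM lte_fin; apply: mulr_gt0; lra.
apply: le_measure; rewrite ?inE//; last exact: measurable_open_plane.
by apply: measurableX; exact: measurable_itv.
Qed.

Lemma enorm_ge0 x : 0 <= enorm x. Proof. exact: sqrtr_ge0. Qed.

Lemma sqr_enorm x : enorm x ^+ 2 = x.1 ^+ 2 + x.2 ^+ 2.
Proof. by rewrite sqr_sqrtr// addr_ge0// sqr_ge0. Qed.

Lemma enorm_le_diam U x y : bounded_set U -> U x -> U y -> enorm (x - y) <= diam U.
Proof.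
move=> /bounded_plane[M M0 hM] Ux Uy; apply: ub_le_sup; last by exists x => //; exists y.
exists (4 * M) => _ [a Ua [b Ub <-]].
have [a1 a2] := hM _ Ua; have [b1 b2] := hM _ Ub.
have M4 : 0 <= 4 * M by rewrite mulr_ge0// ltW.
rewrite -(@ler_sqr _ (enorm _)) ?nnegrE ?enorm_ge0// sqr_enorm/=.
move: a1 a2 b1 b2; rewrite !ltr_norml => /andP[? ?] /andP[? ?] /andP[? ?] /andP[? ?].
have h (p q : R) : - M < p -> p < M -> - M < q -> q < M -> (p - q) ^+ 2 <= (2 * M) ^+ 2.
  move=> p1 p2 q1 q2.
  have : 0 <= (2 * M - (p - q)) * (2 * M + (p - q)) by apply: mulr_ge0; lra.
  by lra.
by apply: (le_trans (lerD (h _ _ _ _ _ _) (h _ _ _ _ _ _))) => //; nra.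
Qed.

Lemma convex_segment U x y (t : R) : convex_set U -> U x -> U y ->
  0 <= t -> t <= 1 -> U (x + t *: (y - x)).
Proof.
move=> cU Ux Uy t0 t1.
have := cU y x (Itv01 t0 t1) (mem_set Uy) (mem_set Ux).
rewrite inE => h.
rewrite (_ : x + t *: (y - x) = t *: y + (1 - t) *: x); first exact: h.
by rewrite scalerBr scalerBl scale1r addrCA.
Qed.

End plane_sets.

(** * Double integrals over the segments of a set *)
Section segments.
Context (R : realType).
Variables (U : set (mplane R)) (mU : measurable U).
Variables (G : mplane R -> \bar R) (mG : measurable_fun [set: mplane R] G).
Hypothesis G0 : forall x, (0 <= G x)%E.
Local Open Scope ereal_scope.

Let ind (x : mplane R) : \bar R := (\1_U x)%:E.

Let ind0 x : 0 <= ind x. Proof. by rewrite lee_fin. Qed.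

Let ind1 x : ind x <= 1. Proof. by rewrite lee_fin indicE lern1 leq_b1. Qed.

Let mind : measurable_fun [set: mplane R] ind.
Proof. by apply/measurable_EFinP; exact: measurable_indic. Qed.

Let int_ind : \int[leb2 R]_x ind x = leb2 R U.
Proof. by rewrite integral_indic ?setIT. Qed.

(** The contribution of the point x + t h to the segment from x to x + h, when
    both endpoints lie in U. *)
Definition segment_weight (x h : plane R) (t : R) : \bar R :=
  ind x * ind (x + h)%R * G (x + t *: h)%R.

Lemma segment_weight_ge0 x h t : 0 <= segment_weight x h t.
Proof. by rewrite /segment_weight !mule_ge0. Qed.

Lemma measurable_segment_weight d (T : measurableType d)
    (fx fh : T -> mplane R) (ft : T -> R) :
  measurable_fun [set: T] fx -> measurable_fun [set: T] fh ->
  measurable_fun [set: T] ft ->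
  measurable_fun [set: T] (fun p => segment_weight (fx p) (fh p) (ft p)).
Proof.
move=> mx mh mt; apply: emeasurable_funM; first apply: emeasurable_funM.
- exact: (measurableT_comp mind mx).
- exact: (measurableT_comp mind (measurable_fun_planeD mx mh)).
- exact: (measurableT_comp mG (measurable_fun_planeD mx (measurable_fun_planeZ mt mh))).
Qed.

(** Forget the condition on x + h; for fixed x, substitute z = x + t h. *)
Lemma segment_weight_far (t : R) : (2^-1 <= t)%R ->
  \int[leb2 R]_h \int[leb2 R]_x segment_weight x h t <=
  (t ^- 2)%:E * (leb2 R U * \int[leb2 R]_z G z).
Proof.
move=> t2; have t0 : (0 < t)%R by lra.
rewrite (@leb2_leb2_swap R (fun h x => segment_weight x h t)); last first.
- by move=> *; exact: segment_weight_ge0.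
- by apply: measurable_segment_weight.
have t20 : 0 <= (t ^- 2)%:E by rewrite lee_fin invr_ge0 exprn_ge0// ltW.
have IG0 : 0 <= \int[leb2 R]_z G z by exact: integral_ge0.
apply: (@le_trans _ _ (\int[leb2 R]_x (ind x * ((t ^- 2)%:E * \int[leb2 R]_z G z)))); last first.
  rewrite ge0_integralZr//; first by rewrite int_ind muleCA.
  exact: mule_ge0.
apply: ge0_le_integral => //.
- by move=> x _; apply: integral_ge0 => h _; exact: segment_weight_ge0.
- apply: (measurable_integral_param (plebesgue R) (f := fun x h => segment_weight x h t)).
  by apply: measurable_segment_weight.
- exact: emeasurable_funM.
move=> x _; rewrite -(integral_plane_affine x t0 mG G0).
rewrite -ge0_integralZl//; last first.
  apply: (measurableT_comp mG); apply: measurable_fun_planeD => //.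
  exact: measurable_fun_planeZ.
apply: ge0_le_integral => //.
- by move=> h _; exact: segment_weight_ge0.
- exact: measurable_segment_weight.
- apply: emeasurable_funM => //.
  apply: (measurableT_comp mG); apply: measurable_fun_planeD => //.
  exact: measurable_fun_planeZ.
move=> h _; rewrite /segment_weight [(t *: _ + _)%R]addrC.
rewrite lee_wpmul2r// -[leRHS]mule1; exact: lee_wpmul2l.
Qed.

(** Forget the condition on x; substitute z = x + t h for fixed h, then
    y = z + (1 - t) h for fixed z. *)
Lemma segment_weight_near (t : R) : (t <= 2^-1)%R ->
  \int[leb2 R]_h \int[leb2 R]_x segment_weight x h t <=
  ((1 - t) ^- 2)%:E * (leb2 R U * \int[leb2 R]_z G z).
Proof.
move=> t2; have t0 : (0 < 1 - t)%R by lra.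
have t20 : 0 <= ((1 - t) ^- 2)%:E by rewrite lee_fin invr_ge0 exprn_ge0// ltW.
have mshift d (T : measurableType d) (fz fh : T -> mplane R) :
    measurable_fun [set: T] fz -> measurable_fun [set: T] fh ->
    measurable_fun [set: T]
      (fun p => ind (((1 - t) *: (fh p : plane R) + fz p)%R : plane R) * G (fz p)).
  move=> mz mh; apply: emeasurable_funM; last exact: measurableT_comp.
  apply: (measurableT_comp mind); apply: measurable_fun_planeD => //.
  by apply: measurable_fun_planeZ.
apply: (@le_trans _ _ (\int[leb2 R]_h \int[leb2 R]_z
    (ind ((1 - t) *: (h : plane R) + z)%R * G z))).
  apply: ge0_le_integral => //.
  - by move=> x _; apply: integral_ge0 => h _; exact: segment_weight_ge0.
  - apply: (measurable_integral_param (plebesgue R) (f := fun h x => segment_weight x h t)).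
    by apply: measurable_segment_weight.
  - apply: (measurable_integral_param (plebesgue R)
      (f := fun h z => ind ((1 - t) *: (h : plane R) + z)%R * G z)).
    by apply: mshift.
  move=> h _.
  rewrite -(integral_plane_shift (t *: h)
    (f := fun z => ind ((1 - t) *: (h : plane R) + z)%R * G z)); last exact: mshift.
  apply: ge0_le_integral => //.
  - by move=> x _; exact: segment_weight_ge0.
  - exact: measurable_segment_weight.
  - by apply: mshift => //; exact: measurable_fun_planeD.
  move=> x _; rewrite /segment_weight lee_wpmul2r//.
  rewrite (_ : ((1 - t) *: h + (x + t *: h))%R = (x + h)%R); last first.
    by rewrite addrCA -scalerDl subrK scale1r.
  by rewrite -[leRHS]mul1e lee_wpmul2r.
rewrite (@leb2_leb2_swap R (fun h z => ind ((1 - t) *: (h : plane R) + z)%R * G z)); last first.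
- by move=> h z; exact: mule_ge0.
- by apply: mshift.
rewrite muleA -ge0_integralZl//; last by rewrite mule_ge0.
apply: ge0_le_integral => //.
- by move=> z _; apply: integral_ge0 => h _; exact: mule_ge0.
- apply: (measurable_integral_param (plebesgue R)
    (f := fun z h => ind ((1 - t) *: (h : plane R) + z)%R * G z)).
  by apply: mshift.
- exact: emeasurable_funM.
move=> z _; rewrite ge0_integralZr//; last first.
  apply: (measurableT_comp mind); apply: measurable_fun_planeD => //.
  exact: measurable_fun_planeZ.
by rewrite (integral_plane_affine z t0 mind ind0) int_ind.
Qed.

(** The two substitutions degenerate at t = 0 and at t = 1 respectively; using
    each of them on the better half of the unit interval costs at most 4. *)
Lemma segment_weight_le (t : R) :
  \int[leb2 R]_h \int[leb2 R]_x segment_weight x h t <=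
  4%:E * (leb2 R U * \int[leb2 R]_z G z).
Proof.
have h (s : R) : (2^-1 <= s)%R -> (s ^- 2)%:E <= 4%:E :> \bar R.
  move=> s2; rewrite lee_fin -[4%R]invrK lef_pV2 ?posrE ?invr_gt0 ?exprn_gt0//; last lra.
  have : (2^-1 ^+ 2 <= s ^+ 2)%R by rewrite ler_sqr ?nnegrE//; lra.
  by apply: le_trans; rewrite expr2; lra.
have I0 : 0 <= leb2 R U * \int[leb2 R]_z G z by rewrite mule_ge0// integral_ge0.
have [t2|t2] := leP 2^-1%R t.
  by apply: (le_trans (segment_weight_far t2)); rewrite lee_wpmul2r// h.
apply: (le_trans (segment_weight_near (ltW t2))); rewrite lee_wpmul2r// h//; lra.
Qed.
End segments.

(** * The Poincare inequality *)
Section poincare.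
Context (R : realType).
Variables (B : plane R -> R) (DB : plane R -> plane R).
Hypotheses (BL2 : L2 B) (HDB : L2_gradient B DB).
Variable U : set (plane R).
Hypotheses (Uopen : open U) (Uconvex : convex_set U) (Ubounded : bounded_set U).
Local Open Scope ereal_scope.

Let mU : measurable (U : set (mplane R)) := measurable_open_plane Uopen.

Let mB : measurable_fun [set: mplane R] B := (sqint_L2 BL2).1.

Definition grad_sqr (z : mplane R) : \bar R := (enorm (DB z) ^+ 2)%:E.

Lemma measurable_grad_sqr : measurable_fun [set: mplane R] grad_sqr.
Proof.
apply/measurable_EFinP.
rewrite (_ : (fun z => _) = fun z => (DB z).1 ^+ 2 + (DB z).2 ^+ 2)%R; last first.
  by apply/funext => z; rewrite sqr_enorm.
apply: measurable_funD; apply: measurable_funX.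
- exact: (sqint_grad HDB ord0).1.
- exact: (sqint_grad HDB (lift ord0 ord0)).1.
Qed.

Let GU := grad_sqr \_ U.

Let mGU : measurable_fun [set: mplane R] GU.
Proof.
apply/(measurable_restrictT _ _).1; first exact: mU.
exact: (measurable_funTS measurable_grad_sqr).
Qed.

Let GU0 z : 0 <= GU z.
Proof. by rewrite /GU patchE; case: ifP => // _; rewrite lee_fin sqr_ge0. Qed.

Let osc (x y : mplane R) : \bar R :=
  (\1_U x)%:E * (\1_U y)%:E * ((B y - B x) ^+ 2)%:E.

Let osc_ge0 x y : 0 <= osc x y.
Proof. by rewrite /osc !mule_ge0 ?lee_fin ?sqr_ge0. Qed.

Let measurable_osc d (T : measurableType d) (fx fy : T -> mplane R) :
  measurable_fun [set: T] fx -> measurable_fun [set: T] fy ->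
  measurable_fun [set: T] (fun p => osc (fx p) (fy p)).
Proof.
move=> mx my; have mi : measurable_fun [set: mplane R] (\1_U : mplane R -> R).
  exact: measurable_indic.
rewrite /osc; under eq_fun do rewrite -!EFinM.
apply/measurable_EFinP; apply: measurable_funM; first apply: measurable_funM.
- exact: (measurableT_comp mi mx).
- exact: (measurableT_comp mi my).
- apply: measurable_funX; apply: measurable_funB.
    exact: (measurableT_comp mB my).
  exact: (measurableT_comp mB mx).
Qed.

(** For almost every x the squared increment is at most the average of
    (h . DB)^2 over the segment, and (h . DB)^2 <= |h|^2 |DB|^2. *)
Lemma osc_le_segment (h : plane R) :
  {ae leb2 R, forall x : mplane R, setT x -> osc x ((x : plane R) + h)%R <=
    (diam U ^+ 2)%:E * \int[leb]_(t in @unit_itv R) segment_weight U GU x h t}.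
Proof.
apply: filterS (increment_ray BL2 HDB h) => x Bx _.
have d20 : 0 <= (diam U ^+ 2)%:E by rewrite lee_fin sqr_ge0.
rewrite /osc; have [xU|xU] := boolP (x \in U); last first.
  rewrite indicE (negbTE xU) !mul0e mule_ge0//.
  by apply: integral_ge0 => t _; exact: segment_weight_ge0.
have [yU|yU] := boolP ((x : plane R) + h \in U)%R; last first.
  rewrite [in X in _ * X * _]indicE (negbTE yU) mule0 mul0e mule_ge0//.
  by apply: integral_ge0 => t _; exact: segment_weight_ge0.
rewrite !indicE xU yU !mul1e Bx.
have hd : (enorm h <= diam U)%R.
  have := enorm_le_diam Ubounded (set_mem yU) (set_mem xU).
  by rewrite addrAC subrr add0r.
apply: (le_trans (sqr_ray h x (sqint_dgrad HDB h).1)).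
have mI := @measurable_unit_itv R.
have mW : measurable_fun (@unit_itv R) (fun t => segment_weight U GU x h t).
  by apply: measurable_funTS; exact: measurable_segment_weight.
rewrite -ge0_integralZl//; last by move=> t _; exact: segment_weight_ge0.
apply: ge0_le_integral => //.
- by move=> t _; rewrite lee_fin sqr_ge0.
- apply: measurable_funTS.
  exact: (measurableT_comp (measurable_sqr (sqint_dgrad HDB h).1) (measurable_ray_section h x)).
- exact: measurable_funeM.
move=> t; rewrite /unit_itv/= in_itv/= => /andP[t0 t1].
have tU : (x + t *: h)%R \in U.
  have := convex_segment Uconvex (set_mem xU) (set_mem yU) t0 t1.
  by rewrite [(_ + h - x)%R]addrAC subrr add0r => /mem_set.
rewrite /segment_weight !indicE xU yU !mul1e /GU patchE tU -EFinM lee_fin.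
apply: (@le_trans _ _ (enorm h ^+ 2 * enorm (DB (x + t *: h)%R) ^+ 2)%R); last first.
  by rewrite ler_wpM2r ?sqr_ge0// ler_sqr ?nnegrE ?enorm_ge0// (le_trans _ hd)// enorm_ge0.
rewrite !sqr_enorm /dgrad; move: (DB _) => [c d] /=; case: h {Bx yU hd mW tU} => [a b] /=.
(* Lagrange's identity *)
by have := sqr_ge0 (a * d - b * c)%R; nra.
Qed.

(** The substitution y = x + h makes the almost-everywhere statement usable: it
    holds for each fixed h, hence under the integral in x taken first. *)
Lemma oscillation_le :
  \int[leb2 R]_(x in U) \int[leb2 R]_(y in U) ((B x - B y) ^+ 2)%:E <=
  (4 * diam U ^+ 2)%:E * (leb2 R U * \int[leb2 R]_(z in U) grad_sqr z).
Proof.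
have -> : \int[leb2 R]_(x in U) \int[leb2 R]_(y in U) ((B x - B y) ^+ 2)%:E =
    \int[leb2 R]_x \int[leb2 R]_y osc x y.
  rewrite integral_mkcond; apply: eq_integral => x _; rewrite patchE.
  case: ifPn => xU.
    rewrite integral_mkcond; apply: eq_integral => y _; rewrite patchE /osc !indicE xU mul1e.
    by case: ifPn => _; rewrite ?mul1e ?mul0e// -sqrrN opprB.
  by rewrite integral0_eq// => y _; rewrite /osc indicE (negbTE xU) !mul0e.
have -> : \int[leb2 R]_x \int[leb2 R]_y osc x y =
    \int[leb2 R]_h \int[leb2 R]_x osc x ((x : plane R) + (h : plane R))%R.
  rewrite -(@leb2_leb2_swap R (fun x h => osc x ((x : plane R) + (h : plane R))%R))//; last first.
    by apply: measurable_osc => //; exact: measurable_fun_planeD.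
  apply: eq_integral => x _.
  rewrite -(integral_plane_shift x (f := osc x)); last exact: measurable_osc.
  by apply: eq_integral => h _; rewrite addrC.
have mI := @measurable_unit_itv R.
have d20 : 0 <= (diam U ^+ 2)%:E by rewrite lee_fin sqr_ge0.
pose m : {sigma_finite_measure set (line R) -> \bar R} := @lebesgue_measure R.
have mW3 : measurable_fun [set: mplane R * line R]
    (fun p => \int[leb2 R]_x segment_weight U GU x p.1 p.2).
  apply: (measurable_integral_param (plebesgue R) (f := fun p x => segment_weight U GU x p.1 p.2)).
  by apply: measurable_segment_weight => //; apply: measurableT_comp.
have mWx h : measurable_fun [set: mplane R]
    (fun x => \int[leb]_(t in @unit_itv R) segment_weight U GU x h t).
  apply: (measurable_integral_param_in m (f := fun x t => segment_weight U GU x h t)) => //.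
  exact: measurable_segment_weight.
have mWh : measurable_fun [set: mplane R]
    (fun h => \int[leb2 R]_x \int[leb]_(t in @unit_itv R) segment_weight U GU x h t).
  apply: (measurable_integral_param (plebesgue R)
    (f := fun h x => \int[m]_(t in @unit_itv R) segment_weight U GU x h t)).
  apply: (measurable_integral_param_in m (f := fun p t => segment_weight U GU p.2 p.1 t)) => //.
  by apply: measurable_segment_weight => //; apply: measurableT_comp.
apply: (@le_trans _ _ (\int[leb2 R]_h ((diam U ^+ 2)%:E *
    \int[leb2 R]_x \int[leb]_(t in @unit_itv R) segment_weight U GU x h t))).
  apply: ge0_le_integral => //.
  - by move=> h _; exact: integral_ge0.
  - apply: (measurable_integral_param (plebesgue R)
      (f := fun h x => osc x ((x : plane R) + (h : plane R))%R)).
    by apply: measurable_osc => //; exact: measurable_fun_planeD.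
  - exact: measurable_funeM.
  move=> h _.
  rewrite -ge0_integralZl//; last first.
    by move=> x _; apply: integral_ge0 => t _; exact: segment_weight_ge0.
  apply: ae_ge0_le_integral => //.
  - by apply: measurable_osc => //; exact: measurable_shift_plane.
  - by move=> x _; rewrite mule_ge0// integral_ge0// => t _; exact: segment_weight_ge0.
  - exact: measurable_funeM.
  - exact: osc_le_segment.
rewrite ge0_integralZl//; last first.
  by move=> h _; apply: integral_ge0 => x _; apply: integral_ge0 => t _; exact: segment_weight_ge0.
rewrite [(4 * _)%R]mulrC (EFinM _ 4) -muleA lee_wpmul2l//.
have -> : \int[leb2 R]_h \int[leb2 R]_x \int[leb]_(t in @unit_itv R) segment_weight U GU x h t =
    \int[leb]_(t in @unit_itv R) \int[leb2 R]_h \int[leb2 R]_x segment_weight U GU x h t.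
  rewrite -(@leb2_itv_swap R _ (fun h t => \int[leb2 R]_x segment_weight U GU x h t))//.
  - apply: eq_integral => h _.
    rewrite (@leb2_itv_swap R _ (fun x t => segment_weight U GU x h t))//.
    + by apply: measurable_segment_weight => //; exact: measurable_snd.
    + by move=> *; exact: segment_weight_ge0.
  - by move=> h t; apply: integral_ge0 => x _; exact: segment_weight_ge0.
apply: (@le_trans _ _ (\int[leb]_(t in @unit_itv R) cst (4%:E * (leb2 R U * \int[leb2 R]_z GU z)) t)).
  apply: ge0_le_integral => //.
  - by move=> t _; apply: integral_ge0 => h _; apply: integral_ge0 => x _; exact: segment_weight_ge0.
  - apply: measurable_funTS.
    apply: (measurable_integral_param (plebesgue R)
      (f := fun t h => \int[leb2 R]_x segment_weight U GU x h t)).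
    apply: (measurable_integral_param (plebesgue R)
      (f := fun p x => segment_weight U GU x p.2 p.1)).
    by apply: measurable_segment_weight => //; apply: measurableT_comp.
  - by move=> t _; exact: segment_weight_le.
rewrite (integral_cst _ mI) [X in _ * X](@leb_unit_itv R) mule1.
by rewrite [in leRHS]integral_mkcond.
Qed.

End poincare.

Section ray_potential.
Context (R : realType).
Variables (B : plane R -> R) (DB : plane R -> plane R).
Hypotheses (BL2 : L2 B) (HDB : L2_gradient B DB).
Variable U : set (plane R).
Hypotheses (Uopen : open U) (Uconvex : convex_set U) (Ubounded : bounded_set U).
Variables (x0 : plane R) (Ux0 : U x0).
Local Open Scope ereal_scope.

Let mU : measurable (U : set (mplane R)) := measurable_open_plane Uopen.

Let mB : measurable_fun [set: mplane R] B := (sqint_L2 BL2).1.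

Let Uoo : leb2 R U < +oo := leb2_bounded_lty mU Ubounded.

Let U0 : 0 < leb2 R U := leb2_open_gt0 Uopen Ux0.

(** The deviation from the mean, written C in the introduction. *)
Let dev (x : mplane R) : R := (B x - Bav B U)%R.

Let mdev : measurable_fun [set: mplane R] dev.
Proof. exact: measurable_funB. Qed.

(** |U| dev(x) is the integral over y in U of B x - B y, to which
    Cauchy-Schwarz applies. *)
Lemma poincare_le :
  \int[leb2 R]_(x in U) (dev x ^+ 2)%:E <=
  (4 * diam U ^+ 2)%:E * \int[leb2 R]_(z in U) grad_sqr DB z.
Proof.
have iB : (leb2 R).-integrable U (EFin \o B).
  exact: sqint_integrable (sqint_L2 BL2) mU Uoo.
have Ufin : leb2 R U \is a fin_num by rewrite ge0_fin_numE// ltW.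
set m := fine (leb2 R U).
have mE : leb2 R U = m%:E by rewrite fineK.
have m0 : (0 < m)%R by rewrite fine_gt0// U0.
have pt (x : mplane R) : m%:E * (dev x ^+ 2)%:E <=
    \int[leb2 R]_(y in U) ((B x - B y) ^+ 2)%:E.
  have h : (\int[leb2 R]_(y in U) (B x - B y) = m * dev x)%R.
    rewrite RintegralB//; last exact: (integrable_cst (B x) mU Uoo).
    rewrite Rintegral_cst// /dev /Bav -/m mulrBr mulrA divff ?gt_eqF// mul1r mulrC.
    by [].
  have mBx : measurable_fun (U : set (mplane R)) (fun y : mplane R => (B x - B y)%R).
    by apply: measurable_funTS; exact: measurable_funB.
  have := sqr_Rintegral_le mU U0 Uoo mBx.
  by rewrite h mE exprMn expr2 -mulrA [X in X <= _ -> _]EFinM lee_pmul2l ?lte_fin// EFinM.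
rewrite -(@lee_pmul2l _ m%:E)//.
rewrite -ge0_integralZl//; last 3 first.
- by apply: measurable_funTS; exact: measurable_sqr.
- by move=> x _; rewrite lee_fin sqr_ge0.
- by rewrite lee_fin ltW.
apply: (le_trans _ (_ : _ <= _)); last first.
  rewrite muleCA -mE; exact: (oscillation_le BL2 HDB Uopen Uconvex Ubounded).
apply: ge0_le_integral => //.
- by move=> x _; rewrite mule_ge0 ?lee_fin ?sqr_ge0// ltW.
- by apply: measurable_funeM; apply: measurable_funTS; exact: measurable_sqr.
- apply: measurable_funTS.
  apply: (measurable_integral_param_in (plebesgue R) (f := fun x y => ((B x - B y) ^+ 2)%:E)) => //.
  apply/measurable_EFinP; apply: measurable_funX; apply: measurable_funB.
    exact: (measurableT_comp mB measurable_fst).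
  exact: (measurableT_comp mB measurable_snd).
Qed.

(** * The ray integral and the field averaged over U *)

Let spoke (x : mplane R) (s : line R) : R :=
  (s * dev ((s : R) *: ((x : plane R) - x0) + x0))%R.

Let mspoke : measurable_fun [set: mplane R * line R] (fun p => spoke p.1 p.2).
Proof.
have ms : measurable_fun [set: mplane R * line R] (fun p : mplane R * line R => p.2 : R).
  exact: (@measurable_snd _ _ (mplane R) (line R)).
apply: measurable_funM => //; apply: (measurableT_comp mdev).
apply: measurable_fun_planeD => //; apply: measurable_fun_planeZ => //.
by apply: measurable_fun_planeD => //; exact: (@measurable_fst _ _ (mplane R) (line R)).
Qed.

(** Tonelli, and for each s > 0 the dilation by s about x0, which maps U into
    itself; its Jacobian compensates the weight s^2. *)
Lemma spoke_le :
  \int[leb2 R]_(x in U) \int[leb]_(s in @unit_itv R) (spoke x s ^+ 2)%:E <=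
  \int[leb2 R]_(x in U) (dev x ^+ 2)%:E.
Proof.
have mI := @measurable_unit_itv R.
pose CU := (fun x : mplane R => (dev x ^+ 2)%:E) \_ U.
have mCU : measurable_fun [set: mplane R] CU.
  by apply/(measurable_restrictT _ _).1; [exact: mU|apply: measurable_funTS; exact: measurable_sqr].
have CU0 x : 0 <= CU x by rewrite /CU patchE; case: ifP => // _; rewrite lee_fin sqr_ge0.
pose f (x : mplane R) (s : line R) :=
  (s ^+ 2)%:E * CU ((s : R) *: (x : plane R) + (x0 - (s : R) *: x0))%R.
have f0 x s : 0 <= f x s by rewrite mule_ge0// lee_fin sqr_ge0.
have mf : measurable_fun [set: mplane R * line R] (fun p => f p.1 p.2).
  have ms : measurable_fun [set: mplane R * line R] (fun p : mplane R * line R => p.2 : R).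
    exact: (@measurable_snd _ _ (mplane R) (line R)).
  apply: emeasurable_funM; first by apply/measurable_EFinP; exact: measurable_funX.
  apply: (measurableT_comp mCU); apply: measurable_fun_planeD.
    by apply: measurable_fun_planeZ => //; exact: (@measurable_fst _ _ (mplane R) (line R)).
  apply: measurable_fun_planeD => //; apply: measurable_fun_planeN.
  exact: measurable_fun_planeZ.
pose m : {sigma_finite_measure set (line R) -> \bar R} := @lebesgue_measure R.
have msp2 : measurable_fun [set: mplane R * line R] (fun p => (spoke p.1 p.2 ^+ 2)%:E).
  by apply/measurable_EFinP; exact: measurable_funX.
apply: (@le_trans _ _ (\int[leb2 R]_x \int[leb]_(s in @unit_itv R) f x s)).
  rewrite integral_mkcond; apply: ge0_le_integral => //.
  - move=> x _; rewrite patchE; case: ifP => // _.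
    by apply: integral_ge0 => s _; rewrite lee_fin sqr_ge0.
  - apply/(measurable_restrictT _ _).1; first exact: mU.
    apply: measurable_funTS.
    exact: (measurable_integral_param_in m (f := fun x s => (spoke x s ^+ 2)%:E)).
  - exact: (measurable_integral_param_in m (f := f)).
  move=> x _; rewrite patchE; case: ifPn => xU; last exact: integral_ge0.
  apply: ge0_le_integral => //.
  - by move=> s _; rewrite lee_fin sqr_ge0.
  - by apply: measurable_funTS; exact: (measurable_fun_pair2 (x : mplane R) msp2).
  - by apply: measurable_funTS; exact: (measurable_fun_pair2 (x : mplane R) mf).
  move=> s; rewrite /unit_itv/= in_itv/= => /andP[s0 s1].
  have E : (s *: (x : plane R) + (x0 - s *: x0) = s *: (x - x0) + x0)%R.
    by rewrite scalerBr addrCA addrC.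
  rewrite /f /CU patchE E ifT; last first.
    by rewrite addrC; apply/mem_set/(convex_segment Uconvex Ux0 (set_mem xU) s0 s1).
  by rewrite /spoke exprMn EFinM.
rewrite leb2_itv_swap//.
apply: (@le_trans _ _ (\int[leb]_(s in @unit_itv R) cst (\int[leb2 R]_x CU x) s)).
  apply: ge0_le_integral => //.
  - by move=> s _; exact: integral_ge0.
  - apply: measurable_funTS.
    apply: (measurable_integral_param (plebesgue R) (f := fun s x => f x s)).
    have msw : measurable_fun [set: line R * mplane R] (fun p => (p.2, p.1) : mplane R * line R).
      by apply: measurable_fun_pair.
    exact: (measurableT_comp mf msw).
  move=> s; rewrite /unit_itv/= in_itv/= => /andP[s0 s1].
  rewrite /f ge0_integralZl ?lee_fin ?sqr_ge0//; last first.
    apply: (measurableT_comp mCU); apply: measurable_fun_planeD => //.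
    exact: measurable_fun_planeZ.
  move: s0; rewrite le_eqVlt => /predU1P[<-|s0].
    by rewrite expr0n mul0e integral_ge0.
  rewrite integral_plane_affine// muleA -EFinM divff ?mul1e//.
  by rewrite expf_neq0// gt_eqF.
rewrite (integral_cst _ mI) [X in _ * X](@leb_unit_itv R) mule1.
by rewrite [leRHS]integral_mkcond.
Qed.

Lemma Rintegral_unit_id : (\int[leb]_(s in @unit_itv R) s = 2^-1)%R.
Proof.
have dF (t : R) : is_derive t (1%R : R) (fun t : R => (2^-1 * t ^+ 2)%R) t.
  have := is_deriveZ 2^-1%R (is_deriveX 2 (is_derive_id t (1%R : R))).
  move=> h; apply: (is_derive_eq h); rewrite /GRing.scale/= expr1.
  by field.
rewrite /Rintegral (@continuous_FTC2 R id (fun t : R => (2^-1 * t ^+ 2)%R) 0 1) ?ltr01//.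
- by rewrite expr1n expr0n/= mulr0 mulr1 subr0.
- by apply: continuous_subspaceT => t; exact: cvg_id.
- have cF := is_derive_continuous dF.
  split.
  + by move=> t _; case: (dF t).
  + by apply: cvg_at_right_filter; exact: cF.
  + by apply: cvg_at_left_filter; exact: cF.
- by move=> t _; rewrite derive1E; case: (dF t).
Qed.

(** The ray integral may diverge, and its value is then a convention; in that
    case s C(x0 + s(x - x0)) is not square integrable in s, since it would be
    integrable otherwise, and the right-hand side is infinite. At x = x0, where
    the ray integral is that of 0, the difference is 0. *)
Lemma Anew_Aav_le (x : plane R) : U x ->
  (enorm (Anew B x0 x - Aav B U x0 x) ^+ 2)%:E <=
  (diam U ^+ 2)%:E * \int[leb]_(s in @unit_itv R) (spoke x s ^+ 2)%:E.
Proof.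
move=> Ux; set c := Bav B U.
have mI := @measurable_unit_itv R.
have I1 : leb (@unit_itv R) = 1 := @leb_unit_itv R.
have I0 : 0 < leb (@unit_itv R) by rewrite I1.
have Ioo : leb (@unit_itv R) < +oo by rewrite I1 ltry.
have msx : measurable_fun (@unit_itv R) (spoke x).
  by apply: measurable_funTS; exact: (measurable_fun_pair2 (x : mplane R) mspoke).
have xd : (enorm (x - x0) <= diam U)%R by exact: enorm_le_diam.
have [y yE] : exists y : plane R, y = (x - x0)%R by exists (x - x0)%R.
rewrite -yE in xd.
set J := \int[leb]_(s in _) _.
have J0 : 0 <= J by apply: integral_ge0 => s _; rewrite lee_fin sqr_ge0.
have RHS0 : 0 <= (diam U ^+ 2)%:E * J by rewrite mule_ge0// lee_fin sqr_ge0.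
have iid : leb.-integrable (@unit_itv R) (EFin \o (fun s : line R => s : R)).
  apply: measurable_bounded_integrable => //.
  exists 1%R; split => // M M1 s; rewrite /unit_itv/= in_itv/= => /andP[s0 s1].
  by rewrite ger0_norm// (le_trans s1)// ltW.
(* the disjunction covers the two cases in which the ray integral splits into
   the contributions of the deviation and of the mean *)
have key (k : R) (e : R -> R) : (k == 0)%R || (J < +oo) -> (forall s, e s = k * s)%R ->
    (\int[leb]_(s in `[0%R, 1%R]) (B (s *: y + x0) * e s) =
     k * (\int[leb]_(s in @unit_itv R) spoke x s + c / 2))%R.
  move=> /orP[/eqP ->|Joo] es.
    transitivity (\int[leb]_(s in @unit_itv R) cst 0%R s)%R.
      by apply: eq_Rintegral => s _; rewrite es mul0r mulr0.
    by rewrite Rintegral_cst// !mul0r.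
  have iw := integrable_sqr mI Ioo msx Joo.
  transitivity (\int[leb]_(s in @unit_itv R) (k * (spoke x s + c * s)))%R.
    by apply: eq_Rintegral => s _; rewrite es /spoke /dev -/c -yE; ring.
  have ics : leb.-integrable (@unit_itv R) (EFin \o (fun s : line R => c * s)%R).
    exact: (integrableZl mI c iid).
  rewrite RintegralZl//; last exact: (integrableD mI iw ics).
  by rewrite RintegralD// RintegralZl// Rintegral_unit_id.
set w := Rintegral leb (@unit_itv R) (spoke x).
have main : (y.1 == 0)%R && (y.2 == 0)%R || (J < +oo) ->
    (enorm (Anew B x0 x - Aav B U x0 x) ^+ 2 = enorm y ^+ 2 * w ^+ 2)%R.
  move=> yJ.
  have yJ1 : (y.1 / 2 == 0)%R || (J < +oo).
    by case/orP: yJ => [/andP[/eqP -> _]|->]; rewrite ?orbT// mul0r eqxx.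
  have yJ2 : (- (y.2 / 2) == 0)%R || (J < +oo).
    by case/orP: yJ => [/andP[_ /eqP ->]|->]; rewrite ?orbT// mul0r oppr0 eqxx.
  have -> : (Anew B x0 x - Aav B U x0 x = (- (w * y.2), w * y.1) :> plane R)%R.
    rewrite /Anew /Aav -yE -/c /A0/=.
    rewrite (key (- (y.2 / 2))%R (fun s => 2^-1 *: - (s *: y.2))%R yJ2); last first.
      by move=> s; rewrite /GRing.scale/=; field.
    rewrite (key (y.1 / 2)%R (fun s => 2^-1 *: (s *: y.1))%R yJ1); last first.
      by move=> s; rewrite /GRing.scale/=; field.
    rewrite -/w; congr pair.
      change (2 * (- (y.2 / 2) * (w + c / 2)) - c * (2^-1 * - y.2) = - (w * y.2))%R.
      by field.
    change (2 * (y.1 / 2 * (w + c / 2)) - c * (2^-1 * y.1) = w * y.1)%R.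
    by field.
  by rewrite !sqr_enorm/=; ring.
have [y0|y0] := eqVneq (enorm y) 0%R.
  have : (y.1 ^+ 2 + y.2 ^+ 2 = 0)%R by rewrite -sqr_enorm y0 expr0n.
  move/eqP; rewrite paddr_eq0 ?sqr_ge0// !sqrf_eq0 => yy.
  by rewrite main ?yy// y0 expr0n mul0r.
have d0 : (0 < diam U)%R.
  by rewrite (lt_le_trans _ xd)// lt_neqAle eq_sym y0 enorm_ge0.
have [->|Joo] := eqVneq J +oo; first by rewrite gt0_muley ?leey// lte_fin exprn_gt0.
have {}Joo : J < +oo by rewrite ltey.
rewrite main ?Joo ?orbT// EFinM; apply: lee_pmul => //; rewrite ?lee_fin ?sqr_ge0//.
  by rewrite ler_sqr ?nnegrE ?enorm_ge0// ltW.
have := sqr_Rintegral_le mI I0 Ioo msx.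
by rewrite [X in X * _]I1 mul1e.
Qed.

Lemma measurable_A0 d (T : measurableType d) (f : T -> mplane R) :
  measurable_fun [set: T] f -> measurable_fun [set: T] (fun x => A0 (f x) : mplane R).
Proof.
move=> mf; apply: (measurable_fun_planeZ (c := fun=> 2^-1%R)) => //.
apply: measurable_fun_plane => /=; last exact: measurable_fun_plane1.
by apply: measurableT_comp => //; exact: measurable_fun_plane2.
Qed.

Lemma measurable_Anew : measurable_fun [set: mplane R] (Anew B x0 : mplane R -> mplane R).
Proof.
pose m : {sigma_finite_measure set (line R) -> \bar R} := @lebesgue_measure R.
pose V (p : mplane R * line R) : mplane R :=
  (B ((p.2 : R) *: ((p.1 : plane R) - x0) + x0) *: A0 ((p.2 : R) *: ((p.1 : plane R) - x0)))%R.
have mV : measurable_fun [set: mplane R * line R] V.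
  have mray : measurable_fun [set: mplane R * line R]
      (fun p => ((p.2 : R) *: ((p.1 : plane R) - x0))%R : mplane R).
    apply: (measurable_fun_planeZ (c := fun p : mplane R * line R => p.2 : R)).
      exact: (@measurable_snd _ _ (mplane R) (line R)).
    by apply: measurable_fun_planeD => //; exact: (@measurable_fst _ _ (mplane R) (line R)).
  apply: measurable_fun_planeZ; last exact: measurable_A0.
  by apply: (measurableT_comp mB); exact: measurable_fun_planeD.
have mI := @measurable_unit_itv R.
apply: (measurable_fun_planeZ (c := fun=> 2%R)) => //.
apply: measurable_fun_plane => /=.
- apply: (measurableT_comp (f := fine) _
    (measurable_integral_param_in m (f := fun x s => ((V (x, s)).1)%:E) mI _)) => //.
  by apply/measurable_EFinP; exact: measurable_fun_plane1 mV.
- apply: (measurableT_comp (f := fine) _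
    (measurable_integral_param_in m (f := fun x s => ((V (x, s)).2)%:E) mI _)) => //.
  by apply/measurable_EFinP; exact: measurable_fun_plane2 mV.
Qed.

Lemma Anew_Aav_integral_le :
  \int[leb2 R]_(x in U) (enorm (Anew B x0 x - Aav B U x0 x) ^+ 2)%:E <=
  (4 * diam U ^+ 4)%:E * \int[leb2 R]_(z in U) grad_sqr DB z.
Proof.
pose m : {sigma_finite_measure set (line R) -> \bar R} := @lebesgue_measure R.
have d20 : 0 <= (diam U ^+ 2)%:E by rewrite lee_fin sqr_ge0.
have msp : measurable_fun [set: mplane R]
    (fun x => \int[m]_(s in @unit_itv R) (spoke x s ^+ 2)%:E).
  apply: (measurable_integral_param_in m (f := fun x s => (spoke x s ^+ 2)%:E)).
    exact: measurable_unit_itv.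
  by apply/measurable_EFinP; exact: measurable_funX.
apply: (@le_trans _ _ (\int[leb2 R]_(x in U) ((diam U ^+ 2)%:E *
    \int[m]_(s in @unit_itv R) (spoke x s ^+ 2)%:E))).
  apply: ge0_le_integral => //.
  - by move=> x _; rewrite lee_fin sqr_ge0.
  - have mdiff : measurable_fun [set: mplane R]
        (fun x => (Anew B x0 x - Aav B U x0 x)%R : mplane R).
      apply: measurable_fun_planeD; first exact: measurable_Anew.
      apply: measurable_fun_planeN; apply: (measurable_fun_planeZ (c := fun=> Bav B U)) => //.
      by apply: measurable_A0; exact: measurable_fun_planeD.
    apply: measurable_funTS; apply/measurable_EFinP.
    under eq_fun do rewrite sqr_enorm.
    apply: measurable_funD; apply: measurable_funX.
      exact: measurable_fun_plane1 mdiff.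
    exact: measurable_fun_plane2 mdiff.
  - by apply: measurable_funTS; exact: measurable_funeM.
  - by move=> x Ux; exact: Anew_Aav_le.
rewrite ge0_integralZl//; last 2 first.
- exact: measurable_funTS.
- by move=> x _; apply: integral_ge0 => s _; rewrite lee_fin sqr_ge0.
apply: (le_trans (lee_wpmul2l d20 (le_trans spoke_le poincare_le))).
rewrite muleA -EFinM lee_wpmul2r//.
  by apply: integral_ge0 => z _; rewrite lee_fin sqr_ge0.
by rewrite lee_fin le_eqVlt; apply/orP; left; apply/eqP; ring.
Qed.
End ray_potential.

Lemma L2norm_sqr (R : realType) (U : set (plane R)) (DB : plane R -> plane R) :
  (L2norm U DB ^+ 2 = \int[leb2 R]_(z in U) grad_sqr DB z)%E.
Proof.
rewrite /L2norm unlock poweR12_sqrt; last by apply: integral_ge0 => x _; exact: poweR_ge0.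
rewrite sqr_sqrte; last by apply: integral_ge0 => x _; exact: poweR_ge0.
rewrite [RHS]integral_mkcond; apply: eq_integral => x _.
rewrite [LHS]poweR_EFin (powR_mulrn 2)// !patchE; case: ifPn => xU.
  by rewrite /grad_sqr ger0_norm ?enorm_ge0.
by rewrite normr0 expr0n.
Qed.

Theorem theorem1p1 (R : realType) (B : plane R -> R) (DB : plane R -> plane R)
    (HB : H1 B) (HDB : L2_gradient B DB)
    (U : set (plane R)) (Uopen : open U) (Uconvex : convex_set U)
    (Ubounded : bounded_set U) (x0 : plane R) (Ux0 : U x0) :
  (\int[leb2 R]_(x in U) (enorm (Anew B x0 x - Aav B U x0 x) ^+ 2)%:E
     <= (8 * diam U ^+ 4)%:E * L2norm U DB ^+ 2)%E.
Proof.
rewrite L2norm_sqr.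
apply: (le_trans (Anew_Aav_integral_le (proj1 HB) HDB Uopen Uconvex Ubounded Ux0)).
apply: lee_wpmul2r; first by apply: integral_ge0 => z _; rewrite lee_fin sqr_ge0.
by rewrite lee_fin ler_wpM2r ?exprn_even_ge0// ler_nat.
Qed.
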